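(* Consider the filtering model $$X_k=f(X_{k-1})+\zeta_k,\qquad Y_k=h(X_k)+\varepsilon_k,$$ with i.i.d. state noise, as described in the context. Assume: (E1) $f$ is $a$-Lipschitz, $h$ is uniformly continuous and surjective, and there are constants $b_0,b$ such that $|x_1-x_2|\le b_0+b|h(x_1)-h(x_2)|$ for all $x_1,x_2\in\mathsf X$; (E2) $\upsilon$ is bounded, $\lim_{|u|\to\infty}\upsilon(u)=0$, and $\inf_{y\in K}\upsilon(y)>0$ for every compact set $K\subset\mathsf Y$; and that $\mathbb E|Z_1^\Delta|<\infty$ for all $\Delta>0$. Let $\{Y_k\}_{k\ge0}$ be the sequence of observations produced by the model. Then, for any probability measures $\nu,\nu'$ on $(\mathsf X,\mathcal X)$ and any $\Delta>0$ such that $$\nu Q\mathbf 1_{\mathsf C(Y_1,\Delta)}>0\ \ \mathbb P_\star\text{-a.s.},\qquad \nu'Q\mathbf 1_{\mathsf C(Y_1,\Delta)}>0\ \ \mathbb P_\star\text{-a.s.},$$ one has $$\limsup_{n\to\infty}n^{-1}\log\big\|\phi_{\nu,n}[Y_{0:n}]-\phi_{\nu',n}[Y_{0:n}]\big\|_{\mathrm{TV}}<0\qquad\mathbb P_\star\text{-a.s.}$$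
   Context: $\mathsf X=\mathbb R^N$ and $\mathsf Y=\mathbb R^p$ with $p\le N$, with Borel $\sigma$-fields $\mathcal X,\mathcal Y$; $f:\mathsf X\to\mathsf X$ and $h:\mathsf X\to\mathsf Y$ are measurable. $\{\varepsilon_k\}_{k\ge0}$ is an i.i.d. sequence with positive density $\upsilon$ with respect to Lebesgue measure on $\mathsf Y$; $\{\zeta_k\}_{k\ge0}$ is an i.i.d. sequence with positive density $\gamma$ with respect to Lebesgue measure on $\mathsf X$, independent of $\{\varepsilon_k\}$. $\mathbb P_\star$ is the law under which $\{Y_k\}$ is generated by the model, the initial state $X_0$ having an arbitrary distribution and being independent of the noises. The transition kernel is $Q(x,A)=\int_A\gamma(x'-f(x))\,dx'$ and the likelihood is $g(x,y)=\upsilon(y-h(x))$. For a probability measure $\nu$ on $\mathsf X$, the filtering distribution is $$\phi_{\nu,n}[y_{0:n}](A)=\frac{\int\nu(dx_0)g(x_0,y_0)\prod_{i=1}^nQ(x_{i-1},dx_i)g(x_i,y_i)\mathbf 1_A(x_n)}{\int\nu(dx_0)g(x_0,y_0)\prod_{i=1}^nQ(x_{i-1},dx_i)g(x_i,y_i)} .$$ $\nu Q\mathbf 1_A=\int\nu(dx)Q(x,A)$, and $\|\cdot\|_{\mathrm{TV}}$ is the total variation norm. For $\Delta>0$, $\mathsf C(y,\Delta)=\{x\in\mathsf X:|h(x)-y|\le\Delta\}$. For $r\ge0$, $\gamma^-(r)=\inf_{|s|\le r}\gamma(s)$ and $\gamma^+(r)=\sup_{|s|\le r}\gamma(s)$;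 it is understood that $0<\gamma^-(r)\le\gamma^+(r)<\infty$ for all $r$ (so that $y\mapsto\mathsf C(y,\Delta)$ is a local Doeblin set function, i.e. for all $y,y'$ there are constants in $(0,\infty)$ bounding $Q(x,A\cap\mathsf C(y',\Delta))$ below and above by multiples of the Lebesgue measure of $A\cap\mathsf C(y',\Delta)$, uniformly in $x\in\mathsf C(y,\Delta)$ and $A\in\mathcal X$). For $\Delta>0$ and $k\ge1$, $$Z_k^\Delta=-\log\gamma^-\big[2(a+1)b_0+(a+1)b\Delta+ab|\varepsilon_{k-1}|+|\zeta_k|+b|\varepsilon_k|\big].$$ *)

(* Defs.v *)
From HB Require Import structures.
From mathcomp Require Import all_boot all_order all_algebra finmap.
From mathcomp Require Import all_classical all_reals all_analysis measurable_realfun.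

Set Implicit Arguments.
Unset Strict Implicit.
Unset Printing Implicit Defensive.

Import Order.TTheory GRing.Theory Num.Theory.
Import numFieldNormedType.Exports.

Local Open Scope classical_set_scope.
Local Open Scope ring_scope.

(* MathComp-Analysis gives 'M[R]_(m, n) its usual topology but no measurable
   structure; this is the Borel sigma-algebra. *)
Section borel_matrix.
Context {R : realType} (m n : nat).

HB.instance Definition _ :=
  isMeasurable.Build ((@open 'M[R]_(m, n)).-sigma)%mdisp 'M[R]_(m, n)
    (@sigma_algebra0 _ setT (@open 'M[R]_(m, n)))
    (@sigma_algebraC _ (@open 'M[R]_(m, n)))
    (@sigma_algebra_bigcup _ setT (@open 'M[R]_(m, n))).

Lemma open_measurable_mx (U : set 'M[R]_(m, n)) : open U -> measurable U.
Proof. exact: sub_sigma_algebra. Qed.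

Lemma measurable_fun_mx d (T : measurableType d) (F : T -> 'M[R]_(m, n)) :
  (forall i j, measurable_fun setT (fun t => F t i j)) ->
  measurable_fun setT F.
Proof.
move=> mF.
apply: (@measurability _ _ _ _ setT F (@open 'M[R]_(m, n))) => //.
move=> _ [U oU <-]; rewrite setTI.
pose box (c : 'M[rat]_(m, n) * rat) : set 'M[R]_(m, n) :=
  [set x | forall i j, ball (ratr (c.1 i j) : R) (ratr c.2) (x i j)].
pose V k : set 'M[R]_(m, n) :=
  if @choice.unpickle ('M[rat]_(m, n) * rat)%type k is Some c then
    if `[< box c `<=` U >] then box c else set0 else set0.
have -> : U = \bigcup_k V k.
  apply/seteqP; split=> [x Ux|x [k _]]; last first.
    by rewrite /V; case: choice.unpickle => // c; case: asboolP => // /[apply].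
  have := open_nbhs_nbhs (conj oU Ux).
  rewrite -nbhs_ballE => -[e /= e0 xeU].
  have [r /andP[r0 re]] : exists r : rat, (0 < r) && (ratr r < e / 2).
    have e2 : 0 < e / 2 by rewrite divr_gt0.
    have [r] := rat_in_itvoo e2; rewrite in_itv/= => /andP[r0 re].
    by exists r; rewrite re andbT -(ltr0q R).
  have rr0 : 0 < ratr r :> R by rewrite ltr0q.
  have /choice[M Mx] : forall ij : 'I_m * 'I_n, exists q : rat,
      ball (ratr q : R) (ratr r) (x ij.1 ij.2).
    move=> [i j]/=.
    have : x i j - ratr r < x i j + ratr r by rewrite ltrD2l gtrN.
    move=> /rat_in_itvoo[q]; rewrite in_itv/= => /andP[q1 q2].
    exists q; rewrite /ball/= ltr_distlC; apply/andP; split.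
      by rewrite ltrBlDr.
    by rewrite -ltrBlDr.
  exists (choice.pickle (\matrix_(i, j) M (i, j), r)) => //.
  have bx : box (\matrix_(i, j) M (i, j), r) x.
    by move=> i j /=; rewrite mxE; exact: (Mx (i, j)).
  rewrite /V choice.pickleK; case: asboolP => // -[].
  move=> y yb; apply: xeU; split=> // i j.
  apply: (@le_ball _ _ _ (ratr r + ratr r)).
    by rewrite -mulr2n -mulr_natr -ler_pdivlMr// ltW.
  apply: ball_triangle (yb i j).
  exact/ball_sym/bx.
rewrite preimage_bigcup; apply: bigcupT_measurable => k.
rewrite /V; case: choice.unpickle => [c|]; last by rewrite preimage_set0.
case: asboolP => _; last by rewrite preimage_set0.
rewrite [X in measurable X](_ : _ = \bigcap_(ij in [set: 'I_m * 'I_n])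
    ((fun t => F t ij.1 ij.2) @^-1` ball (ratr (c.1 ij.1 ij.2) : R) (ratr c.2))).
  apply: fin_bigcap_measurable => // ij _.
  rewrite -[X in measurable X]setTI; apply: mF => //.
  exact: measurable_ball.
apply/seteqP; split=> t /= Ht; first by move=> ij _; exact: Ht.
by move=> i j; exact: (Ht (i, j)).
Qed.

End borel_matrix.

Lemma measurable_coord (R : realType) m n i j :
  measurable_fun setT (fun x : 'M[R]_(m, n) => x i j).
Proof.
apply: (measurability _ (RGenOpens.measurableE R)).
move=> _ [_ [a [b ->] <-]]; rewrite setTI; apply: open_measurable_mx.
by move/continuousP: (@coord_continuous R m n i j); apply; exact: interval_open.
Qed.

Lemma measurable_fun_mxP (R : realType) m n d (T : measurableType d) (F : T -> 'M[R]_(m, n)) :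
  measurable_fun setT F <->
  (forall i j, measurable_fun setT (fun t => F t i j)).
Proof.
split=> [mF i j|]; last exact: measurable_fun_mx.
exact: (measurableT_comp (measurable_coord i j) mF).
Qed.

Definition consV (R : realType) n (tv : R * 'rV[R]_n) : 'rV[R]_n.+1 :=
  row_mx (tv.1%:M : 'rV_1) tv.2.

(* Lebesgue measure on R^n as an iterated product measure, transported along
   R * R^n -> R^(n+1); lebesgue_rV_box below computes it on boxes. *)
Fixpoint lebesgue_rV (R : realType) (n : nat) : set 'rV[R]_n -> \bar R :=
  match n with
  | 0 => dirac (0 : 'rV[R]_0)
  | n'.+1 => pushforward (lebesgue_measure \x @lebesgue_rV R n')%E (@consV R n')
  end.

Lemma measurable_consV (R : realType) n :
  measurable_fun setT (@consV R n).
Proof.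
apply: measurable_fun_mx => i j.
rewrite (_ : (fun _ => _) = fun tv : R * 'rV[R]_n =>
    if fintype.split (j : 'I_(1 + n)) is inr k then tv.2 0 k else tv.1); last first.
  apply/funext => tv; rewrite (ord1 i) mxE.
  by case: (fintype.split _) => // k; rewrite ord1 mxE eqxx mulr1n.
case: (fintype.split _) => [_|k]; first exact: measurable_fst.
exact: (measurableT_comp (measurable_coord 0 k) measurable_snd).
Qed.

Section lebesgue_rV_step.
Context {R : realType} (n : nat) (mu : {sigma_finite_measure set 'rV[R]_n -> \bar R}).
Local Open Scope ereal_scope.

Definition lebesgue_rV_succ :=
  pushforward (lebesgue_measure \x mu) (@consV R n).
Local Notation nu := lebesgue_rV_succ.

Let nu0 : nu set0 = 0.
Proof. by rewrite /lebesgue_rV_succ /pushforward preimage_set0 measure0. Qed.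

Let nu_ge0 A : 0 <= nu A.
Proof. by rewrite /lebesgue_rV_succ /pushforward; exact: measure_ge0. Qed.

Let nu_sigma_additive : semi_sigma_additive nu.
Proof.
move=> F mF tF mUF; rewrite /lebesgue_rV_succ /pushforward preimage_bigcup.
apply: measure_semi_sigma_additive.
- by move=> k; rewrite -[X in measurable X]setTI; exact: measurable_consV.
- apply/trivIsetP => /= i j _ _ ij; rewrite -preimage_setI.
  by move/trivIsetP : tF => /(_ _ _ _ _ ij) ->//; rewrite preimage_set0.
- by rewrite -preimage_bigcup -[X in measurable X]setTI; exact: measurable_consV.
Qed.

HB.instance Definition _ := isMeasure.Build _ _ _ nu
  nu0 nu_ge0 nu_sigma_additive.

Let nu_sigma_finite : sigma_finite setT nu.
Proof.
have [F TF Foo] : sigma_finite setT (lebesgue_measure \x mu).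
  have /sigma_finiteP[F [TF ndF Foo]] := sigma_finiteT (@lebesgue_measure R).
  have /sigma_finiteP[G [TG ndG Goo]] := sigma_finiteT mu.
  exists (fun k => F k `*` G k).
    rewrite -setXTT TF TG predeqE => -[x y]; split.
      move=> [/= [i _ Fi] [k _ Gky]]; exists (maxn i k) => //; split.
      - by move: x Fi; exact/subsetPset/ndF/leq_maxl.
      - by move: y Gky; exact/subsetPset/ndG/leq_maxr.
    by move=> [i _ []/= ? ?]; split; exists i.
  move=> k; have [? ?] := Foo k; have [? ?] := Goo k.
  split; first exact: measurableX.
  by rewrite product_measure1E// lte_mul_pinfty// ge0_fin_numE.
have mg : measurable_fun setT (fun v : 'rV[R]_n.+1 =>
    (v ord0 ord0, \row_(j < n) v ord0 (lift ord0 j))).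
  apply/measurable_fun_pairP; split; first exact: measurable_coord.
  apply: measurable_fun_mx => i j /=.
  under eq_fun do rewrite mxE.
  exact: measurable_coord.
have consVK tv : (@consV R n tv ord0 ord0, \row_(j < n) consV tv ord0 (lift ord0 j)) = tv.
  case: tv => t v; congr pair.
    rewrite /consV mxE; case: splitP => // k _.
    by rewrite (ord1 k) mxE eqxx mulr1n.
  apply/rowP => j; rewrite mxE /consV mxE; case: splitP => /= k.
    by case: k => -[].
  by rewrite /bump/= !add1n => -[] /val_inj ->.
exists (fun k => (fun v : 'rV[R]_n.+1 =>
    (v ord0 ord0, \row_(j < n) v ord0 (lift ord0 j))) @^-1` F k).
  by rewrite -preimage_bigcup -TF preimage_setT.
move=> k; have [mFk Fkoo] := Foo k; split.
  by rewrite -[X in measurable X]setTI; exact: mg.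
rewrite /lebesgue_rV_succ /pushforward (_ : _ @^-1` _ = F k)//.
by apply/seteqP; split=> tv /=; rewrite consVK.
Qed.

HB.instance Definition _ := Measure_isSigmaFinite.Build _ _ _ nu nu_sigma_finite.

Lemma lebesgue_rV_step : exists nu' : {sigma_finite_measure set 'rV[R]_n.+1 -> \bar R},
  (nu' : set 'rV[R]_n.+1 -> \bar R) = nu.
Proof. by exists nu. Qed.

End lebesgue_rV_step.

Section lebesgue_rV_measure.
Context {R : realType} (n : nat).
Local Open Scope ereal_scope.

Let lebesgue_rV_ex : exists mu : {sigma_finite_measure set 'rV[R]_n -> \bar R},
  (mu : set 'rV[R]_n -> \bar R) = @lebesgue_rV R n.
Proof.
elim: n => [|k [mu mumu]]; first by exists (dirac (0%R : 'rV[R]_0)).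
by rewrite /= -mumu; exact: lebesgue_rV_step.
Qed.

Let lebesgue_rV0 : @lebesgue_rV R n set0 = 0.
Proof. by have [mu <-] := lebesgue_rV_ex; exact: measure0. Qed.

Let lebesgue_rV_ge0 A : 0 <= @lebesgue_rV R n A.
Proof. by have [mu <-] := lebesgue_rV_ex; exact: measure_ge0. Qed.

Let lebesgue_rV_sigma_additive : semi_sigma_additive (@lebesgue_rV R n).
Proof. by have [mu <-] := lebesgue_rV_ex; exact: measure_semi_sigma_additive. Qed.

HB.instance Definition _ := isMeasure.Build _ _ _ (@lebesgue_rV R n)
  lebesgue_rV0 lebesgue_rV_ge0 lebesgue_rV_sigma_additive.

Let lebesgue_rV_sigma_finite : sigma_finite setT (@lebesgue_rV R n).
Proof. by have [mu <-] := lebesgue_rV_ex; exact: sigma_finiteT. Qed.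

HB.instance Definition _ := Measure_isSigmaFinite.Build _ _ _ (@lebesgue_rV R n)
  lebesgue_rV_sigma_finite.

End lebesgue_rV_measure.

Lemma lebesgue_rV_box (R : realType) n (a b : 'I_n -> R) :
  (forall i, a i <= b i) ->
  @lebesgue_rV R n [set v : 'rV[R]_n | forall i, v 0 i \in `]a i, b i]] =
  (\prod_(i < n) (b i - a i))%:E.
Proof.
elim: n a b => [|n IH] a b ab.
  rewrite big_ord0 /= /dirac indicE mem_set//.
  by case.
rewrite /= /pushforward.
rewrite [X in (_ \x _)%E X](_ : _ = [set` `]a ord0, b ord0]] `*`
    [set v : 'rV[R]_n | forall i : 'I_n, v 0 i \in `](a (lift ord0 i)), (b (lift ord0 i))]]).
  rewrite product_measure1E//; last first.
    rewrite [X in measurable X](_ : _ = \bigcap_(i in [set: 'I_n])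
        ((fun v : 'rV[R]_n => v 0 i) @^-1` [set` `](a (lift ord0 i)), (b (lift ord0 i))]])).
      apply: fin_bigcap_measurable => // i _.
      by rewrite -[X in measurable X]setTI; apply: measurable_coord.
    apply/seteqP; split=> v /= Hv; first by move=> i _; exact: Hv.
    by move=> i; exact: Hv.
  rewrite [X in (_ * X)%E](IH (a \o lift ord0) (b \o lift ord0)); last first.
    by move=> i; exact: ab.
  rewrite [X in (X * _)%E](lebesgue_measure_itv `]a ord0, b ord0]).
  rewrite /= lte_fin big_ord_recl EFinM.
  case: ltP => // ba; congr (_ * _)%E.
  have /eqP -> : b ord0 == a ord0 by rewrite eq_le ba ab.
  by rewrite subrr.
have cons0 t (v : 'rV[R]_n) : consV (t, v) 0 ord0 = t.
  rewrite /consV mxE; case: splitP => // k _.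
  by rewrite (ord1 k) mxE eqxx mulr1n.
have consS t (v : 'rV[R]_n) j : consV (t, v) 0 (lift ord0 j) = v 0 j.
  rewrite /consV mxE; case: splitP => /= k; first by case: k => -[].
  by rewrite /bump/= !add1n => -[] /val_inj ->.
apply/seteqP; split=> [[t v]/= H|[t v]/= [H1 H2] i].
  split; first by have := H ord0; rewrite cons0.
  by move=> i; have := H (lift ord0 i); rewrite consS.
case: (unliftP ord0 i) => [j ->|->]; last by rewrite cons0.
by rewrite consS.
Qed.

(* Euclidean norm; the library's `|x| on row vectors is the sup norm. *)
Definition enorm (R : realType) n (x : 'rV[R]_n) : R :=
  Num.sqrt (\sum_(i < n) x 0 i ^+ 2).

Section probabilistic_notions.
Context d (Omega : measurableType d) (R : realType) (P : probability Omega R).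
Context d' (E : measurableType d').
Local Open Scope ereal_scope.

Definition mutually_independent (I : choiceType) (X : I -> Omega -> E) :=
  forall (J : {fset I}) (B : I -> set E), (forall i, measurable (B i)) ->
    P (\bigcap_(i in [set` J]) X i @^-1` B i) =
    \prod_(i <- J) P (X i @^-1` B i).

Definition sigma_of (I : Type) (X : I -> Omega -> E) : set (set Omega) :=
  <<s \bigcup_i preimage_set_system setT (X i) measurable >>.

Definition independent_sigma (F G : set (set Omega)) :=
  forall A B, F A -> G B -> P (A `&` B) = P A * P B.

End probabilistic_notions.

Definition has_density d (Omega : measurableType d) (R : realType)
    (P : probability Omega R) n (X : Omega -> 'rV[R]_n) (q : 'rV[R]_n -> R) :=
  forall A, measurable A ->
    P (X @^-1` A) = (\int[@lebesgue_rV R n]_(x in A) (q x)%:E)%E.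

Definition iid_with_density d (Omega : measurableType d) (R : realType)
    (P : probability Omega R) n (X : nat -> Omega -> 'rV[R]_n)
    (q : 'rV[R]_n -> R) :=
  mutually_independent P X /\ forall k, has_density P (X k) q.

(* Total variation norm |mu|(T) of a finite signed measure, as a supremum over
   finite measurable partitions (blocks may be empty). *)
Definition tv_norm d (T : measurableType d) (R : realType)
    (mu : set T -> R) : \bar R :=
  ereal_sup [set s | exists k (A : 'I_k -> set T),
    [/\ forall i, measurable (A i), trivIset setT A, \bigcup_i A i = setT
      & s = (\sum_(i < k) `|mu (A i)|)%:E]].

Section filtering_model.
Context (R : realType) (N p : nat).
Local Notation X := 'rV[R]_N.
Local Notation Y := 'rV[R]_p.
Variables (f : X -> X) (h : X -> Y) (upsilon : Y -> R) (gamma : X -> R).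
Local Open Scope ereal_scope.

Section trajectories.
Variables (Omega : Type) (X0 : Omega -> X).
Variables (eps : nat -> Omega -> Y) (zeta : nat -> Omega -> X).

Fixpoint state (k : nat) (w : Omega) : X :=
  if k is k'.+1 then (f (state k' w) + zeta k w)%R else X0 w.

Definition observation (k : nat) (w : Omega) : Y :=
  (h (state k w) + eps k w)%R.

End trajectories.

(* The transition kernel Q(x, A). *)
Definition transition (x : X) (A : set X) : \bar R :=
  \int[@lebesgue_rV R N]_(x' in A) (gamma (x' - f x))%:E.

Definition likelihood (x : X) (y : Y) : R := upsilon (y - h x).

(* path_integral y k n A x is
   \int Q(x, dx_{k+1}) g(x_{k+1}, y_{k+1}) ... Q(x_{k+n-1}, dx_{k+n})
   g(x_{k+n}, y_{k+n}) 1_A(x_{k+n}). *)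
Fixpoint path_integral (y : nat -> Y) (k n : nat) (A : set X) (x : X) : \bar R :=
  if n is n'.+1 then
    \int[transition x]_x'
      ((likelihood x' (y k.+1))%:E * path_integral y k.+1 n' A x')
  else (\1_A x)%:E.

Definition unnormalized_filter (nu : set X -> \bar R) (n : nat) (y : nat -> Y)
    (A : set X) : \bar R :=
  \int[nu]_x ((likelihood x (y 0%N))%:E * path_integral y 0 n A x).

(* phi_{nu,n}[y_{0:n}](A): only the values y 0, ..., y n are used. *)
Definition filtering (nu : set X -> \bar R) (n : nat) (y : nat -> Y)
    (A : set X) : R :=
  (fine (unnormalized_filter nu n y A) /
   fine (unnormalized_filter nu n y setT))%R.

(* The set C(y, Delta). *)
Definition local_set (y : Y) (Delta : R) : set X :=
  [set x | (enorm (h x - y) <= Delta)%R].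

(* Taken in \bar R, so that an unbounded gamma has supremum +oo instead of the
   junk value 0 of [sup]. *)
Definition gamma_minus (r : R) : \bar R :=
  ereal_inf [set (gamma s)%:E | s in [set s | (enorm s <= r)%R]].

Definition gamma_plus (r : R) : \bar R :=
  ereal_sup [set (gamma s)%:E | s in [set s | (enorm s <= r)%R]].

(* Z_k^Delta, meaningful for k >= 1; lne is the logarithm on \bar R. *)
Definition Zvar (Omega : Type) (eps : nat -> Omega -> Y)
    (zeta : nat -> Omega -> X) (a b0 b Delta : R) (k : nat) (w : Omega) :
    \bar R :=
  - lne (gamma_minus (2 * (a + 1) * b0 + (a + 1) * b * Delta +
      a * b * enorm (eps k.-1 w) + enorm (zeta k w) + b * enorm (eps k w))%R).

End filtering_model.

(* Main.v *)
Require Import Defs.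
From HB Require Import structures.
From mathcomp Require Import all_boot all_order all_algebra finmap.
From mathcomp Require Import all_classical all_reals all_analysis.
From mathcomp Require Import measurable_realfun zify ring lra.

Set Implicit Arguments.
Unset Strict Implicit.
Unset Printing Implicit Defensive.

Import Order.TTheory GRing.Theory Num.Theory.
Import numFieldNormedType.Exports.

Local Open Scope classical_set_scope.
Local Open Scope ring_scope.

(** The filter is a quotient of integrals over trajectories of the signal. For
    two initial laws, the numerator of the difference of the two filters is an
    integral over pairs of independent trajectories, started from the two laws,
    of a function that is antisymmetric in the pair. Two effects make it small
    in comparison with the product of the two likelihoods.
    - Suppose that both components lie in the local set of y_k at time k and in
      that of y_(k+1) at time k+1. The transition density of the pair is then at
      least a constant lo ^ 2, and at most hi ^ 2. The constant part is
      symmetric and does not contribute to the integral, so that only a fraction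
      theta = 1 - (lo / hi) ^ 2 of the density remains.
    - If one component is outside of the local set, the product of the two
      likelihoods at that time is at most eta M instead of M ^ 2, where eta bounds
      the noise density upsilon outside of a ball.
    Lemma path_weight_contraction combines the two by induction on the number of
    steps: for every m, the numerator is bounded by theta raised to the number of
    good times minus about 2 m, times the product of the likelihoods, plus
    M ^ (2 n) (eta / M) ^ m.

    The second term has to be compared with the likelihoods themselves. Keeping
    only the trajectories that stay in the local sets of a fixed radius Delta
    bounds a likelihood from below by a constant times the product of the factors
    kappa exp (- max (0, Z_k)) (likelihood_lower); as Z_k has a finite mean, this
    product is almost surely at least a geometric sequence rho ^ n for large n. The constants are therefore chosen in this order:
    rho from the law of large numbers at radius Delta, then eta so small that
    (eta / M) ^ (n / 8) beats (M / rho) ^ (2 n), then a radius outside of which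
    upsilon is at most eta, and last a level B that the noises exceed so rarely
    that most times are good; B determines lo, hi and theta (forgetting_rate).

    The observations need be neither stationary nor ergodic, since the quantities
    above are controlled by the noises alone: the k-th one is a function of
    eps_(k-1), eps_k and zeta_k. These triples have the same law, and two of them
    are independent if their indices differ by 2 or more, so that a law of large
    numbers applies to the even and to the odd ones (step_noise_sum). Only an
    upper bound on the averages is needed; strong_law_upper_bound derives it from
    pairwise independence, by truncation, the Chebyshev inequality and the
    Borel-Cantelli lemma along the powers of 2. *)

(** * Euclidean norm and Lebesgue measure *)

Section euclidean_norm.
Context (R : realType) (n : nat).
Implicit Types x y z : 'rV[R]_n.

Lemma enorm_ge0 x : 0 <= enorm x.
Proof. exact: sqrtr_ge0. Qed.

Lemma sqr_enorm x : enorm x ^+ 2 = \sum_i x 0 i ^+ 2.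
Proof. by rewrite sqr_sqrtr// sumr_ge0// => i _; exact: sqr_ge0. Qed.

Lemma enormB x y : enorm (x - y) = enorm (y - x).
Proof.
rewrite /enorm; congr Num.sqrt; apply: eq_bigr => i _.
by rewrite !mxE -sqrrN opprB.
Qed.

Lemma ler_coord_enorm x i : `|x 0 i| <= enorm x.
Proof.
rewrite -sqrtr_sqr ler_wsqrtr// (bigD1 i)//= lerDl.
by rewrite sumr_ge0// => j _; exact: sqr_ge0.
Qed.

Lemma ler_enorm_sup x (r : R) : 0 <= r ->
  (forall i, `|x 0 i| <= r) -> enorm x <= n%:R * r.
Proof.
move=> r0 xr; rewrite -(ger0_norm (_ : 0 <= n%:R * r)) ?mulr_ge0//.
rewrite -sqrtr_sqr ler_wsqrtr//.
apply: (@le_trans _ _ (\sum_(i < n) r ^+ 2)).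
  apply: ler_sum => i _; rewrite -(real_normK (num_real (x 0 i))).
  by rewrite ler_sqr ?nnegrE.
rewrite sumr_const card_ord exprMn -[leLHS]mulr_natl.
apply: ler_wpM2r; first exact: sqr_ge0.
case: n => [|k]; first by rewrite expr0n.
by rewrite expr2 ler_peMl// ler1n.
Qed.

(** Cauchy-Schwarz, from Lagrange's identity. *)
Lemma enorm_cauchy_schwarz x y : \sum_i x 0 i * y 0 i <= enorm x * enorm y.
Proof.
have CS : (\sum_i x 0 i * y 0 i) ^+ 2 <= (\sum_i x 0 i ^+ 2) * \sum_i y 0 i ^+ 2.
  have : 0 <= \sum_i \sum_j (x 0 i * y 0 j - x 0 j * y 0 i) ^+ 2.
    by apply: sumr_ge0 => i _; apply: sumr_ge0 => j _; exact: sqr_ge0.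
  suff -> : \sum_i \sum_j (x 0 i * y 0 j - x 0 j * y 0 i) ^+ 2 =
      2 * ((\sum_i x 0 i ^+ 2) * (\sum_i y 0 i ^+ 2) - (\sum_i x 0 i * y 0 i) ^+ 2).
    by rewrite pmulr_rge0// subr_ge0.
  transitivity (\sum_i (x 0 i ^+ 2 * (\sum_j y 0 j ^+ 2)
      + y 0 i ^+ 2 * (\sum_j x 0 j ^+ 2)
      - 2 * (x 0 i * y 0 i) * \sum_j x 0 j * y 0 j)).
    apply: eq_bigr => i _; rewrite !mulr_sumr -big_split/= -sumrB.
    by apply: eq_bigr => j _; ring.
  by rewrite sumrB big_split/= -!mulr_suml -mulr_sumr; ring.
apply: (le_trans (ler_norm _)).
rewrite -[leRHS]ger0_norm ?mulr_ge0 ?enorm_ge0//.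
rewrite -ler_sqr ?nnegrE// !real_normK ?num_real//.
by rewrite exprMn !sqr_enorm.
Qed.

Lemma ler_enormD x y : enorm (x + y) <= enorm x + enorm y.
Proof.
rewrite -ler_sqr ?nnegrE ?addr_ge0 ?enorm_ge0//.
rewrite sqr_enorm sqrrD !sqr_enorm.
rewrite (eq_bigr (fun i => x 0 i ^+ 2 + 2 * (x 0 i * y 0 i) + y 0 i ^+ 2)); last first.
  by move=> i _; rewrite mxE sqrrD mulr_natl.
rewrite !big_split/= lerD2r lerD2l -mulr_sumr -[leRHS]mulr_natl ler_pM2l//.
exact: enorm_cauchy_schwarz.
Qed.

Lemma ler_enorm_dist y x z : enorm (x - z) <= enorm (x - y) + enorm (y - z).
Proof.
by rewrite (le_trans _ (ler_enormD _ _))// addrA subrK.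
Qed.

Lemma enorm0 : enorm (0 : 'rV[R]_n) = 0.
Proof.
rewrite /enorm big1 ?sqrtr0// => i _.
by rewrite mxE expr0n.
Qed.

Lemma measurable_enorm : measurable_fun setT (@enorm R n).
Proof.
rewrite /enorm; apply: (@measurableT_comp _ _ _ _ _ _ (@Num.sqrt R)).
  apply: nondecreasing_measurable => // x y; exact: ler_wsqrtr.
by apply: measurable_sum => i; apply: measurable_funX; exact: measurable_coord.
Qed.

End euclidean_norm.

Definition image_measure d d' (T : measurableType d) (T' : measurableType d')
    (R : realType) (mu : {measure set T -> \bar R}) (g : T -> T')
    (mg : measurable_fun setT g) : {measure set T' -> \bar R} :=
  measure_function_pushforward__canonical__measure_function_Measure mu mg.

Lemma measurable_fun_rVB (R : realType) d (T : measurableType d) n (F G : T -> 'rV[R]_n) :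
  measurable_fun setT F -> measurable_fun setT G -> measurable_fun setT (fun t => F t - G t).
Proof.
move=> mF mG; apply/measurable_fun_mxP => i j.
under eq_fun do rewrite !mxE.
by apply: measurable_funB; move: i j; apply/measurable_fun_mxP.
Qed.

Section lebesgue_rV_translation.
Context (R : realType).
Local Notation lam n := (@lebesgue_rV R n).

Lemma measurable_translation n (c : 'rV[R]_n) :
  measurable_fun setT (fun z : 'rV[R]_n => z + c).
Proof.
apply/measurable_fun_mxP => i j; under eq_fun do rewrite mxE.
by apply: measurable_funD => //; exact: measurable_coord.
Qed.

Lemma lebesgue_measure_translation (t : R) (A : set R) : measurable A ->
  lebesgue_measure ((fun s => s + t) @^-1` A) = lebesgue_measure A.
Proof.
have mt : measurable_fun setT ((fun s => s + t) : R -> measurableTypeR R).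
  exact: measurable_funD.
move=> mA; rewrite -[LHS]/(pushforward (@lebesgue_measure R)
  ((fun s => s + t) : _ -> measurableTypeR R) A).
apply/esym/lebesgue_measure_unique => //= _ [[a b]] _ <-.
rewrite /pushforward (_ : _ @^-1` _ = `]a - t, b - t]%classic); last first.
  by apply/seteqP; split => s /=; rewrite !in_itv/= ltrBlDr lerBrDr.
rewrite !lebesgue_measure_itv/= !lte_fin ltrD2r.
by case: ifPn => // _; rewrite -!EFinB; congr EFin; ring.
Qed.

(** Induction on the dimension, the product of two translation invariant
    measures being translation invariant by uniqueness of product measures. *)
Lemma lebesgue_rV_translation n (c : 'rV[R]_n) (A : set 'rV[R]_n) :
  measurable A -> lam n ((fun z => z + c) @^-1` A) = lam n A.
Proof.
elim: n c A => [|n IH] c A mA.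
  congr lebesgue_rV; apply/seteqP; split => z /=;
  by rewrite (_ : z + c = z)//; apply/rowP => -[].
pose c' : 'rV[R]_n := \row_j c 0 (lift ord0 j).
pose S (tv : R * 'rV[R]_n) := (tv.1 + c 0 0, tv.2 + c').
have mS : measurable_fun setT S.
  apply/measurable_fun_pairP; split => /=.
    by apply: measurable_funD => //; exact: measurable_fst.
  exact: (measurableT_comp (measurable_translation c') measurable_snd).
have mcA : measurable (@consV R n @^-1` A).
  by rewrite -[X in measurable X]setTI; exact: measurable_consV.
rewrite /= /pushforward.
have -> : consV (n:=n) @^-1` ((fun z => z + c) @^-1` A) = S @^-1` (@consV R n @^-1` A).
  apply/seteqP; split => -[t v]/=; rewrite /S/= (_ : consV (t, v) + c =
      consV (t + c 0 0, v + c'))//; apply/rowP => j; rewrite !mxE;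
    case: splitP => k jk; rewrite ?mxE/=.
  - by rewrite (ord1 k) eqxx !mulr1n; congr (_ + c _ _); apply/val_inj; rewrite /= jk ord1.
  - by congr (_ + c _ _); apply/val_inj.
  - by rewrite (ord1 k) eqxx !mulr1n; congr (_ + c _ _); apply/val_inj; rewrite /= jk ord1.
  - by congr (_ + c _ _); apply/val_inj.
have mS' : measurable_fun (T := (measurableTypeR R * 'rV[R]_n)%type)
    (U := (measurableTypeR R * 'rV[R]_n)%type) setT S := mS.
rewrite -[LHS]/(pushforward (lebesgue_measure \x @lebesgue_rV R n)%E S _).
apply/esym; apply: (product_measure_unique (m1 := lebesgue_measure)
  (m2 := @lebesgue_rV R n) (m' := image_measure (lebesgue_measure \x @lebesgue_rV R n)%E mS'))
  => // X Y mX mY.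
rewrite /image_measure/=.
rewrite /pushforward (_ : S @^-1` _ =
    ((fun s => s + c 0 0) @^-1` X) `*` ((fun z => z + c') @^-1` Y))//.
rewrite product_measure1E/=.
- by rewrite lebesgue_measure_translation// IH.
- rewrite -[X in measurable X]setTI.
  by apply: (measurable_funD (f := id) (g := cst (c 0 0))).
- by rewrite -[X in measurable X]setTI; exact: measurable_translation.
Qed.

Lemma ge0_integral_lebesgue_rV_translation n (c : 'rV[R]_n) (F : 'rV[R]_n -> \bar R) :
  measurable_fun setT F -> (forall z, 0 <= F z)%E ->
  (\int[lam n]_z F (z + c)%R = \int[lam n]_z F z)%E.
Proof.
move=> mF F0.
have mT := measurable_translation c.
transitivity (\int[image_measure (lam n) mT]_z F z)%E.
  by rewrite ge0_integral_pushforward.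
by apply: eq_measure_integral => A mA _; exact: lebesgue_rV_translation.
Qed.

End lebesgue_rV_translation.

Section density.
Local Open Scope ereal_scope.
Context d (T : measurableType d) (R : realType).
Variables (mu nu : {measure set T -> \bar R}) (q : T -> R).
Hypotheses (mq : measurable_fun setT q) (q0 : forall x, (0 <= q x)%R).
Hypothesis nuE : forall A, measurable A -> nu A = \int[mu]_(x in A) (q x)%:E.

Import HBNNSimple.

(** Monotone convergence reduces the change of density to simple functions, for
    which it is the hypothesis on nu. *)
Lemma ge0_integral_density (F : T -> \bar R) :
  measurable_fun setT F -> (forall x, 0 <= F x) ->
  \int[nu]_x F x = \int[mu]_x ((q x)%:E * F x).
Proof.
move=> mF F0; pose h := nnsfun_approx measurableT mF.
have mqE : measurable_fun setT (EFin \o q) by exact/measurable_EFinP.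
have cvgh x : (EFin \o h ^~ x) @ \oo --> F x by exact: cvg_nnsfun_approx.
transitivity (limn (fun n => \int[nu]_x (h n x)%:E)).
  rewrite -monotone_convergence//.
  - by apply: eq_integral => x _; apply/esym/cvg_lim => //; exact: cvgh.
  - by move=> n; exact/measurable_EFinP.
  - by move=> n x _; rewrite lee_fin.
  - by move=> x _ a b ab; rewrite lee_fin; exact/lefP/nd_nnsfun_approx.
transitivity (limn (fun n => \int[mu]_x ((q x)%:E * (h n x)%:E))); last first.
  rewrite -monotone_convergence//.
  - apply: eq_integral => x _; apply/cvg_lim => //.
    by apply: cvgeZl => //; exact: cvgh.
  - by move=> n; apply: emeasurable_funM => //; exact/measurable_EFinP.
  - by move=> n x _; rewrite mule_ge0// lee_fin.
  - move=> x _ a b ab; rewrite lee_wpmul2l ?lee_fin//.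
    exact/lefP/nd_nnsfun_approx.
congr (limn _); apply/funext => n.
rewrite integralT_nnsfun sintegralE.
transitivity (\int[mu]_x (\sum_(y \in range (h n))
    (y%:E * ((q x)%:E * (\1_(h n @^-1` [set y]) x)%:E)))); last first.
  apply: eq_integral => x _; rewrite [in RHS]fimfunE -fsumEFin// ge0_mule_fsumr; last first.
    by move=> y; rewrite lee_fin; exact: nnfun_muleindic_ge0.
  by apply: eq_fsbigr => y _; rewrite EFinM muleCA.
have y0 y x : 0 <= y%:E * ((q x)%:E * (\1_(h n @^-1` [set y]) x)%:E).
  have := nnfun_muleindic_ge0 (h n) y x => /= yh.
  by rewrite muleCA mule_ge0 ?lee_fin.
rewrite ge0_integral_fsum//; last first.
  move=> y; apply: emeasurable_funM => //; apply: emeasurable_funM => //.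
  exact/measurable_EFinP.
apply: eq_fsbigr => y /set_mem [x _ <-].
rewrite ge0_integralZl//.
- congr (_ * _); rewrite nuE// integral_mkcond; apply: eq_integral => z _.
  rewrite patchE indicE; case: ifPn => zh.
  + by rewrite mule1.
  + by rewrite mule0.
- apply: emeasurable_funM => //; exact/measurable_EFinP.
- by move=> z _; rewrite mule_ge0// lee_fin.
- by rewrite lee_fin.
Qed.

End density.

Lemma integral_pos_gt0 (R : realType) d (T : measurableType d) (mu : {measure set T -> \bar R})
    (D : set T) (F : T -> R) : measurable D -> measurable_fun D F ->
  (forall x, D x -> 0 < F x) -> (0 < mu D)%E -> (0 < \int[mu]_(x in D) (F x)%:E)%E.
Proof.
move=> mD mF F0 muD; rewrite lt0e integral_ge0 ?andbT; last first.
  by move=> x Dx; rewrite lee_fin ltW// F0.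
apply/eqP => I0; have : ae_eq mu D (EFin \o F) (cst 0%E).
  apply/ae_eq_integral_abs => //; first exact/measurable_EFinP.
  rewrite -[RHS]I0; apply: eq_integral => x /set_mem Dx /=.
  by rewrite ger0_norm// ltW// F0.
move=> [Z [mZ Z0 ZF]]; move: muD; rewrite ltNge => /negP; apply.
rewrite -Z0; apply: le_measure; rewrite ?inE//.
move=> x Dx; apply: ZF => /= /(_ Dx) [] F_0.
by have := F0 _ Dx; rewrite F_0 ltxx.
Qed.

(** * Independent random variables and a strong law of large numbers *)

Section independent_expectation.
Context d (Omega : measurableType d) (R : realType) (P : probability Omega R).
Local Open Scope ereal_scope.

Definition independent_pair d1 d2 (E : measurableType d1) (F : measurableType d2)
    (X : Omega -> E) (Y : Omega -> F) :=
  forall A B, measurable A -> measurable B ->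
    P (X @^-1` A `&` Y @^-1` B) = P (X @^-1` A) * P (Y @^-1` B).

Definition same_law d1 (E : measurableType d1) (X Y : Omega -> E) :=
  forall A, measurable A -> P (X @^-1` A) = P (Y @^-1` A).

Lemma same_law_integral d1 (E : measurableType d1) (X Y : Omega -> E)
    (phi : E -> \bar R) :
  measurable_fun setT X -> measurable_fun setT Y -> same_law X Y ->
  measurable_fun setT phi -> (forall x, 0 <= phi x) ->
  \int[P]_w phi (X w) = \int[P]_w phi (Y w).
Proof.
move=> mX mY XY mphi phi0.
transitivity (\int[image_measure P mX]_x phi x).
  by rewrite ge0_integral_pushforward.
transitivity (\int[image_measure P mY]_x phi x); last first.
  by rewrite ge0_integral_pushforward.
by apply: eq_measure_integral => A mA _; exact: XY.
Qed.

(** The joint law of an independent pair is the product of the laws. *)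
Lemma independent_pair_law d1 d2 (E : measurableType d1) (F : measurableType d2)
    (X : {mfun Omega >-> E}) (Y : {mfun Omega >-> F}) : independent_pair X Y ->
  forall S, measurable S ->
    P ((fun w => (X w, Y w)) @^-1` S) = (distribution P X \x distribution P Y) S.
Proof.
move=> XY S mS.
have mXY : measurable_fun setT (fun w => (X w, Y w)).
  by apply/measurable_fun_pairP; split.
apply/esym.
by rewrite (product_measure_unique (m' := image_measure P mXY)).
Qed.

(** By the product law of the pair and the Tonelli theorem. *)
Lemma independent_pair_integral (X Y : {mfun Omega >-> R}) (phi psi : R -> R) :
  independent_pair X Y ->
  measurable_fun setT phi -> measurable_fun setT psi ->
  (forall x, 0 <= phi x)%R -> (forall x, 0 <= psi x)%R ->
  \int[P]_w (phi (X w) * psi (Y w))%:E =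
  \int[P]_w (phi (X w))%:E * \int[P]_w (psi (Y w))%:E.
Proof.
move=> XY mphi mpsi phi0 psi0.
have mXY : measurable_fun setT (fun w => (X w, Y w)).
  by apply/measurable_fun_pairP; split.
pose F (z : R * R) := (phi z.1 * psi z.2)%:E.
have mF : measurable_fun setT F.
  apply/measurable_EFinP; apply: measurable_funM.
    exact: (measurableT_comp mphi measurable_fst).
  exact: (measurableT_comp mpsi measurable_snd).
have F0 z : 0 <= F z by rewrite lee_fin mulr_ge0.
transitivity (\int[image_measure P mXY]_z F z).
  by rewrite ge0_integral_pushforward.
transitivity (\int[distribution P X \x distribution P Y]_z F z).
  by apply: eq_measure_integral => A mA _; exact: independent_pair_law.
rewrite fubini_tonelli1// /fubini_F.
have EX (Z : {mfun Omega >-> R}) (f : R -> R) : measurable_fun setT f ->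
    (forall x, 0 <= f x)%R ->
    \int[distribution P Z]_x (f x)%:E = \int[P]_w (f (Z w))%:E.
  move=> mf f0; by rewrite ge0_integral_distribution//; exact/measurable_EFinP.
rewrite -(EX X phi)// -(EX Y psi)//.
rewrite -ge0_integralZr//.
- apply: eq_integral => x _; rewrite -ge0_integralZl//.
  + exact/measurable_EFinP.
  + by move=> y _; rewrite lee_fin.
  + by rewrite lee_fin.
- exact/measurable_EFinP.
- by move=> y _; rewrite lee_fin.
- by apply: integral_ge0 => y _; rewrite lee_fin.
Qed.

End independent_expectation.

Section strong_law_upper_bound.
Context d (Omega : measurableType d) (R : realType) (P : probability Omega R).
Variables (xi : nat -> {mfun Omega >-> R}) (c : R).
Hypotheses (xi0 : forall i w, 0 <= xi i w).
Hypothesis xi_ind : forall i j, i != j -> independent_pair P (xi i) (xi j).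
Hypothesis xi_law : forall i, same_law P (xi i) (xi 0%N).
Hypothesis xi_mean : (\int[P]_w (xi 0%N w)%:E < c%:E)%E.

(** On the first 2 ^ m terms, the variables are truncated at 2 ^ m. *)
Local Notation tr m := (fun x : R => Num.min x (2 ^+ m)).

Let tr_ge0 m x : 0 <= x -> 0 <= tr m x.
Proof. by move=> x0; rewrite le_min x0 exprn_ge0. Qed.

Let c_gt0 : 0 < c.
Proof.
rewrite -lte_fin (le_lt_trans _ xi_mean)//.
by apply: integral_ge0 => w _; rewrite lee_fin.
Qed.

(** Each dyadic scale below x contributes its own size, and the scales above x
    contribute a geometric series. *)
Lemma sum_sqr_truncation (x : R) M : 0 <= x ->
  \sum_(m < M) 2 ^- m * Num.min x (2 ^+ m) ^+ 2 <= 4 * x.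
Proof.
move=> x0.
suff: (2 ^+ M <= x -> \sum_(m < M) 2 ^- m * tr m x ^+ 2 <= 2 ^+ M) /\
      (x <= 2 ^+ M -> \sum_(m < M) 2 ^- m * tr m x ^+ 2 + 2 * (x ^+ 2 / 2 ^+ M) <= 4 * x).
  have [xM [_ /(_ isT)]|xM [/(_ (ltW xM)) + _]] := leP x (2 ^+ M).
    by apply: le_trans; rewrite lerDl !mulr_ge0 ?sqr_ge0// invr_ge0 exprn_ge0.
  by move=> /le_trans; apply; rewrite (le_trans (ltW xM))// ler_peMl// ler1n.
elim: M => [|M [IH1 IH2]].
  rewrite big_ord0 expr0 add0r divr1; split => // x1.
  by rewrite expr2 mulrA; apply: ler_wpM2r => //; lra.
have M0 : 0 < 2 ^+ M :> R by rewrite exprn_gt0.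
rewrite big_ord_recr/= exprS; split => [Mx|xM].
  have Mx' : 2 ^+ M <= x by lra.
  rewrite (min_idPr Mx') expr2 mulKf ?gt_eqF//.
  by have := IH1 Mx'; lra.
have -> : 2 * (x ^+ 2 / (2 * 2 ^+ M)) = x ^+ 2 / 2 ^+ M.
  by field; rewrite gt_eqF.
have [xM'|xM'] := leP x (2 ^+ M).
  by rewrite mulrC; have := IH2 xM'; lra.
rewrite expr2 mulKf ?gt_eqF//.
have := IH1 (ltW xM').
have : x ^+ 2 / 2 ^+ M <= 2 * x.
  by rewrite ler_pdivrMr// expr2; nra.
lra.
Qed.

Let mtr m : measurable_fun setT (fun x : R => tr m x).
Proof. exact: measurable_minr. Qed.

Let mtr2 m : measurable_fun setT (fun x : R => tr m x ^+ 2).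
Proof. exact: measurable_funX. Qed.

Let h m i w : R := tr m (xi i w).

Let h0 m i w : 0 <= h m i w. Proof. exact: tr_ge0. Qed.

Let mh m i : measurable_fun setT (h m i).
Proof. exact: (measurableT_comp (mtr m)). Qed.

Let a m : R := fine (\int[P]_w (h m 0%N w)%:E)%E.
Let s m : R := fine (\int[P]_w (h m 0%N w ^+ 2)%:E)%E.

Let h_le m i w : h m i w <= 2 ^+ m.
Proof. by rewrite ge_min lexx orbT. Qed.

Let aE m : (\int[P]_w (h m 0%N w)%:E = (a m)%:E)%E /\ 0 <= a m < c.
Proof.
have ac : (\int[P]_w (h m 0%N w)%:E < c%:E)%E.
  apply: le_lt_trans xi_mean; apply: ge0_le_integral => //.
  - by move=> w _; rewrite lee_fin.
  - exact/measurable_EFinP.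
  - exact/measurable_EFinP.
  - by move=> w _; rewrite lee_fin ge_min lexx.
have a0 : (0 <= \int[P]_w (h m 0%N w)%:E)%E.
  by apply: integral_ge0 => w _; rewrite lee_fin.
have E : (\int[P]_w (h m 0%N w)%:E = (a m)%:E)%E.
  by rewrite fineK// ge0_fin_numE// (lt_trans ac)// ltry.
by split => //; rewrite -lee_fin -lte_fin -E a0.
Qed.

Let sE m : (\int[P]_w (h m 0%N w ^+ 2)%:E = (s m)%:E)%E /\ 0 <= s m.
Proof.
have s0 : (0 <= \int[P]_w (h m 0%N w ^+ 2)%:E)%E.
  by apply: integral_ge0 => w _; rewrite lee_fin sqr_ge0.
have E : (\int[P]_w (h m 0%N w ^+ 2)%:E = (s m)%:E)%E.
  rewrite fineK// ge0_fin_numE// (@le_lt_trans _ _ (\int[P]_w ((2 ^+ m) ^+ 2)%:E)%E)//.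
    apply: ge0_le_integral => //.
    - by move=> w _; rewrite lee_fin sqr_ge0.
    - by apply/measurable_EFinP; exact: measurable_funX.
    - by move=> w _; rewrite lee_fin ler_sqr ?nnegrE ?h0 ?exprn_ge0.
  by rewrite integral_cst//= probability_setT mule1 ltry.
by split => //; rewrite -lee_fin -E.
Qed.

Let Eh m i : (\int[P]_w (h m i w)%:E = (a m)%:E)%E.
Proof.
rewrite -(aE m).1.
have -> : (\int[P]_w (h m i w)%:E = \int[P]_w (Num.max 0 (tr m (xi i w)))%:E)%E.
  by apply: eq_integral => w _; rewrite (max_idPr (h0 m i w)).
rewrite (same_law_integral (X := xi i) (Y := xi 0%N)
  (phi := fun x => (Num.max 0 (tr m x))%:E))//.
- by apply: eq_integral => w _; rewrite (max_idPr (h0 m 0%N w)).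
- by apply/measurable_EFinP; exact: measurable_maxr.
- by move=> x; rewrite lee_fin le_max lexx.
Qed.

Let Eh2 m i : (\int[P]_w (h m i w ^+ 2)%:E = (s m)%:E)%E.
Proof.
rewrite -(sE m).1 (same_law_integral (X := xi i) (Y := xi 0%N)
  (phi := fun x => (tr m x ^+ 2)%:E))//.
- exact/measurable_EFinP.
- by move=> x; rewrite lee_fin sqr_ge0.
Qed.

Let Ehh m i j : i != j -> (\int[P]_w (h m i w * h m j w)%:E = (a m * a m)%:E)%E.
Proof.
move=> ij.
have H k w : Num.max 0 (tr m (xi k w)) = h m k w by apply/max_idPr; exact: h0.
under eq_integral do rewrite -!H.
rewrite (independent_pair_integral (X := xi i) (Y := xi j)
  (phi := fun x => Num.max 0 (tr m x)) (psi := fun x => Num.max 0 (tr m x)))//.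
- by under eq_integral do rewrite H; under [X in (_ * X)%E]eq_integral do rewrite H;
    rewrite !Eh.
- exact: xi_ind.
- exact: measurable_maxr.
- exact: measurable_maxr.
- by move=> x; rewrite le_max lexx.
- by move=> x; rewrite le_max lexx.
Qed.

Let n m : R := (2 ^ m)%:R.
Let S m w : R := \sum_(i < 2 ^ m) h m i w.

Let n_gt0 m : 0 < n m. Proof. by rewrite ltr0n expn_gt0. Qed.

Let mS m : measurable_fun setT (S m).
Proof. exact: measurable_sum. Qed.

Let S0 m w : 0 <= S m w. Proof. exact: sumr_ge0. Qed.

Let ES m : (\int[P]_w (S m w)%:E = (n m * a m)%:E)%E.
Proof.
under eq_integral do rewrite -sumEFin.
rewrite ge0_integral_sum//; last 2 first.
- by move=> i; exact/measurable_EFinP.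
- by move=> i w _; rewrite lee_fin.
under eq_bigr do rewrite Eh.
by rewrite sumEFin sumr_const card_ord -[X in X%:E]mulr_natl.
Qed.

Let ES2 m : (\int[P]_w (S m w ^+ 2)%:E = ((n m * a m) ^+ 2 + n m * (s m - a m ^+ 2))%:E)%E.
Proof.
transitivity (\int[P]_w (\sum_(i < 2 ^ m) \sum_(j < 2 ^ m) (h m i w * h m j w)%:E))%E.
  apply: eq_integral => w _; rewrite expr2 mulr_suml -sumEFin.
  by apply: eq_bigr => i _; rewrite mulr_sumr sumEFin.
have mhh i j : measurable_fun setT (fun w => (h m i w * h m j w)%:E).
  by apply/measurable_EFinP; exact: measurable_funM.
have hh0 i j w : (0 <= (h m i w * h m j w)%:E)%E by rewrite lee_fin mulr_ge0.
rewrite ge0_integral_sum//; last 2 first.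
- by move=> i; apply: emeasurable_sum => j.
- by move=> i w _; apply: sume_ge0 => j _.
transitivity (\sum_(i < 2 ^ m) (n m * a m ^+ 2 + (s m - a m ^+ 2))%:E)%E; last first.
  rewrite sumEFin sumr_const card_ord -[X in X%:E]mulr_natl; congr EFin.
  by rewrite -/(n m); ring.
apply: eq_bigr => i _; rewrite ge0_integral_sum//.
rewrite (bigD1 i)//= [X in (X + _)%E](Eh2 m i).
rewrite (eq_bigr (fun _ => (a m ^+ 2)%:E)); last first.
  by move=> j ji; rewrite Ehh// eq_sym.
rewrite sumEFin sumr_const -EFinD; congr EFin.
have -> : n m = 1 + #|[pred j : 'I_(2 ^ m) | j != i]|%:R.
  rewrite /n -[X in X%:R](card_ord (2 ^ m)) (cardD1 i) inE natrD.
  by congr (_ + _%:R); apply: eq_card => j; rewrite !inE andbT.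
by rewrite -mulr_natl; ring.
Qed.

(** From (S - n a) ^ 2 + 2 n a S = S ^ 2 + (n a) ^ 2, in which all terms are
    nonnegative. *)
Let var_S m : (\int[P]_w ((S m w - n m * a m) ^+ 2)%:E <= (n m * s m)%:E)%E.
Proof.
have [_ /andP[a0 ac]] := aE m.
have na0 : 0 <= n m * a m by rewrite mulr_ge0// ltW.
have m1 : measurable_fun setT (fun w => ((S m w - n m * a m) ^+ 2)%:E).
  by apply/measurable_EFinP; apply: measurable_funX; exact: measurable_funB.
have E : (\int[P]_w ((S m w - n m * a m) ^+ 2)%:E + (2 * (n m * a m) ^+ 2)%:E =
    (2 * (n m * a m) ^+ 2 + n m * (s m - a m ^+ 2))%:E)%E.
  have -> : ((2 * (n m * a m) ^+ 2)%:E =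
      \int[P]_w (2 * (n m * a m) * S m w)%:E)%E.
    under eq_integral do rewrite EFinM.
    rewrite ge0_integralZl//.
    - by rewrite ES -EFinM; congr EFin; ring.
    - exact/measurable_EFinP.
    - by move=> w _; rewrite lee_fin.
    - by rewrite lee_fin mulr_ge0.
  rewrite -ge0_integralD//; last 3 first.
  - by move=> w _; rewrite lee_fin sqr_ge0.
  - by move=> w _; rewrite lee_fin !mulr_ge0.
  - by apply/measurable_EFinP; exact: measurable_funM.
  transitivity (\int[P]_w ((S m w ^+ 2)%:E + ((n m * a m) ^+ 2)%:E))%E.
    by apply: eq_integral => w _; rewrite -!EFinD; congr EFin; ring.
  rewrite ge0_integralD//; last 3 first.
  - by move=> w _; rewrite lee_fin sqr_ge0.
  - by apply/measurable_EFinP; exact: measurable_funX.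
  - by move=> w _; rewrite lee_fin sqr_ge0.
  by rewrite ES2 integral_cst//= probability_setT mule1 -EFinD; congr EFin; ring.
have : (\int[P]_w ((S m w - n m * a m) ^+ 2)%:E + (2 * (n m * a m) ^+ 2)%:E <=
   (n m * s m)%:E + (2 * (n m * a m) ^+ 2)%:E)%E.
  rewrite E -EFinD lee_fin; have : 0 <= n m * a m ^+ 2 by rewrite mulr_ge0 ?sqr_ge0// ltW.
  by lra.
by rewrite leeD2rE.
Qed.

(** At a point where this function is less than 1, no term of the scale m
    reaches the truncation level, and the truncated sum deviates from its mean by
    less than n c. Both facts thus follow from one Markov inequality. *)
Let bad m w : R := (S m w - n m * a m) ^+ 2 / (n m * c) ^+ 2
  + \sum_(i < 2 ^ m) h m i w ^+ 2 / n m ^+ 2.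

Let mbad m : measurable_fun setT (bad m).
Proof.
apply: measurable_funD.
  by apply: measurable_funM => //; apply: measurable_funX; exact: measurable_funB.
by apply: measurable_sum => i; apply: measurable_funM => //; exact: measurable_funX.
Qed.

Let bad_mean m : (\int[P]_w (bad m w)%:E <= ((c ^- 2 + 1) * (2 ^- m * s m))%:E)%E.
Proof.
have nc : 0 < (n m * c) ^+ 2 by rewrite exprn_gt0// mulr_gt0.
have n2 : 0 < n m ^+ 2 by rewrite exprn_gt0.
have mV : measurable_fun setT (fun w => ((S m w - n m * a m) ^+ 2)%:E).
  by apply/measurable_EFinP; apply: measurable_funX; exact: measurable_funB.
have mh2 i : measurable_fun setT (fun w => (h m i w ^+ 2)%:E).
  by apply/measurable_EFinP; exact: measurable_funX.
rewrite (eq_integral (fun w => ((n m * c) ^- 2)%:E * ((S m w - n m * a m) ^+ 2)%:E +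
    (n m ^- 2)%:E * \sum_(i < 2 ^ m) (h m i w ^+ 2)%:E)%E); last first.
  move=> w _; rewrite /bad sumEFin -!EFinM -EFinD; congr EFin.
  by rewrite mulrC -mulr_suml [X in _ + X]mulrC.
have i1 : (0 <= ((n m * c) ^- 2)%:E)%E by rewrite lee_fin invr_ge0 ltW.
have i2 : (0 <= (n m ^- 2)%:E)%E by rewrite lee_fin invr_ge0 ltW.
rewrite ge0_integralD//; last 4 first.
- by move=> w _; rewrite mule_ge0// lee_fin sqr_ge0.
- exact: emeasurable_funM.
- by move=> w _; rewrite mule_ge0// sume_ge0// => i _; rewrite lee_fin sqr_ge0.
- by apply: emeasurable_funM => //; exact: emeasurable_sum.
rewrite !ge0_integralZl//; last 3 first.
- exact: emeasurable_sum.
- by move=> w _; rewrite sume_ge0// => i _; rewrite lee_fin sqr_ge0.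
- by move=> w _; rewrite lee_fin sqr_ge0.
rewrite ge0_integral_sum//; last by move=> i w _; rewrite lee_fin sqr_ge0.
under [X in (_ + _ * X)%E]eq_bigr do rewrite Eh2.
rewrite sumEFin sumr_const card_ord -[X in (_ * X%:E)%E]mulr_natl -/(n m).
apply: (@le_trans _ _ (((n m * c) ^- 2)%:E * (n m * s m)%:E + (n m ^- 2 * (n m * s m))%:E)%E).
  by rewrite leeD2r// lee_wpmul2l// var_S.
rewrite -EFinM -EFinD lee_fin -natrX -/(n m).
rewrite le_eqVlt; apply/orP; left; apply/eqP.
by field; rewrite !gt_eqF.
Qed.

Let B m := [set w | 1 <= bad m w].

Let bad_ge0 m w : 0 <= bad m w.
Proof.
rewrite addr_ge0// ?divr_ge0 ?sqr_ge0// sumr_ge0// => i _.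
by rewrite divr_ge0 ?sqr_ge0.
Qed.

Let mB m : measurable (B m).
Proof.
rewrite [B m](_ : _ = setT `&` bad m @^-1` `[1, +oo[); first exact: mbad.
by rewrite setTI; apply/seteqP; split => w /=; rewrite in_itv/= andbT.
Qed.

Let PB m : (P (B m) <= ((c ^- 2 + 1) * (2 ^- m * s m))%:E)%E.
Proof.
apply: le_trans (bad_mean m).
rewrite -[B m]setIT -integral_indic//; apply: ge0_le_integral => //.
- exact/measurable_EFinP.
- exact/measurable_EFinP.
- move=> w _; rewrite lee_fin indicE.
  by have [wB|_] := boolP (w \in B m); [exact: (set_mem wB)|exact: bad_ge0].
Qed.

Let sumPB M : (\sum_(m < M) P (B m) <= ((c ^- 2 + 1) * (4 * c))%:E)%E.
Proof.
have c2 : 0 <= c ^- 2 + 1 by rewrite addr_ge0// invr_ge0 sqr_ge0.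
apply: (@le_trans _ _ (\sum_(m < M) ((c ^- 2 + 1) * (2 ^- m * s m))%:E)%E).
  by apply: lee_sum.
rewrite sumEFin -mulr_sumr lee_fin ler_wpM2l//.
rewrite -lee_fin -sumEFin.
rewrite (eq_bigr (fun m : 'I_M => \int[P]_w ((2 ^- m * h m 0%N w ^+ 2)%:E))%E); last first.
  move=> m _; under eq_integral do rewrite EFinM.
  rewrite ge0_integralZl// ?(sE m).1//.
  - by apply/measurable_EFinP; exact: measurable_funX.
  - by move=> w _; rewrite lee_fin sqr_ge0.
rewrite -ge0_integral_sum//; last 2 first.
- by move=> m; apply/measurable_EFinP; apply: measurable_funM => //; exact: measurable_funX.
- by move=> m w _; rewrite lee_fin mulr_ge0 ?sqr_ge0.
apply: (@le_trans _ _ (\int[P]_w (4%:E * (xi 0%N w)%:E))%E).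
  apply: ge0_le_integral => //.
  - by move=> w _; apply: sume_ge0 => m _; rewrite lee_fin mulr_ge0 ?sqr_ge0.
  - apply: emeasurable_sum => m; apply/measurable_EFinP.
    by apply: measurable_funM => //; exact: measurable_funX.
  - by apply: emeasurable_funM => //; exact/measurable_EFinP.
  - by move=> w _; rewrite sumEFin -EFinM lee_fin; exact: sum_sqr_truncation.
rewrite ge0_integralZl//.
- by rewrite EFinM lee_wpmul2l// ltW.
- exact/measurable_EFinP.
- by move=> w _; rewrite lee_fin.
Qed.

Let good_scale m w : ~ B m w -> \sum_(i < 2 ^ m) xi i w <= 2 * c * n m.
Proof.
move=> /negP; rewrite -ltNge => badw.
have [_ /andP[a0 ac]] := aE m.
have nc : 0 < n m * c by rewrite mulr_gt0.
have t0 i : 0 <= h m i w ^+ 2 / n m ^+ 2 by rewrite divr_ge0 ?sqr_ge0.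
have v0 : 0 <= (S m w - n m * a m) ^+ 2 / (n m * c) ^+ 2 by rewrite divr_ge0 ?sqr_ge0.
have xih (i : 'I_(2 ^ m)) : xi i w = h m i w.
  have : h m i w ^+ 2 / n m ^+ 2 < 1.
    apply: le_lt_trans badw.
    by rewrite /bad (bigD1 i)//= addrCA lerDl addr_ge0// sumr_ge0.
  rewrite ltr_pdivrMr ?exprn_gt0// mul1r ltr_pXn2r ?nnegrE// ?ltW//.
  rewrite /h /n natrX => lt2; apply/esym/min_idPl; rewrite leNgt; apply/negP => /ltW xx.
  by move: lt2; rewrite (min_idPr xx) ltxx.
under eq_bigr do rewrite xih.
rewrite -/(S m w).
have : (S m w - n m * a m) ^+ 2 < (n m * c) ^+ 2.
  rewrite -[X in _ < X]mul1r -ltr_pdivrMr ?exprn_gt0//.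
  by apply: le_lt_trans badw; rewrite lerDl sumr_ge0.
rewrite -[X in X < _](real_normK (num_real _)) ltr_pXn2r ?nnegrE ?normr_ge0 ?(ltW nc)// => SS.
have := le_lt_trans (ler_norm _) SS.
have : n m * a m <= n m * c by rewrite ler_wpM2l// ltW.
lra.
Qed.

(** The bad scales have summable probabilities, so that almost surely all large
    scales are good; n lies between two powers of 2, which costs a factor 2 on
    top of the factor 2 of the deviation bound. *)
Theorem strong_law_upper_bound :
  {ae P, forall w, exists n0, forall n, (n0 <= n)%N ->
    \sum_(i < n) xi i w <= 4 * c * n%:R}.
Proof.
have P0 : P (lim_sup_set B) = 0%E.
  apply: lim_sup_set_cvg0 => //.
  apply: (@le_lt_trans _ _ ((c ^- 2 + 1) * (4 * c))%:E); last exact: ltry.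
  apply: lime_le; first exact: is_cvg_nneseries.
  by apply: nearW => M; rewrite big_mkord; exact: sumPB.
exists (lim_sup_set B); split => //.
  by apply: bigcap_measurable => // k _; exact: bigcup_measurable.
move=> w /= nw; apply: contrapT => nB; apply: nw.
have [m0 Bm0] : exists m0, forall m, (m0 <= m)%N -> ~ B m w.
  apply: contrapT => H; apply: nB => k _.
  apply: contrapT => H'; apply: H; exists k => m km Bm.
  by apply: H'; exists m.
exists (2 ^ m0)%N => k mk.
have k0 : (0 < k)%N by rewrite (leq_trans _ mk)// expn_gt0.
pose m := (trunc_log 2 k).+1.
have /andP[mk1 mk2] : (2 ^ m.-1 <= k < 2 ^ m)%N by exact: trunc_log_bounds.
have m0m : (m0 <= m)%N.
  by rewrite -ltnS -(ltn_exp2l _ _ (isT : 1 < 2)%N) (leq_ltn_trans mk)// (ltn_trans mk2)// ltn_exp2l.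
apply: (@le_trans _ _ (\sum_(i < 2 ^ m) xi i w)).
  rewrite -!(big_mkord xpredT (fun i => xi i w)) (@big_cat_nat _ _ _ k 0 (2 ^ m))//=; last exact: ltnW.
  by rewrite lerDl sumr_ge0.
apply: (le_trans (good_scale (Bm0 _ m0m))).
have : n m <= 2 * k%:R by rewrite /n -natrM ler_nat expnS leq_mul2l mk1.
by have := c_gt0; nra.
Qed.

End strong_law_upper_bound.

Section independence.
Context d (Omega : measurableType d) (R : realType) (P : probability Omega R).
Local Open Scope ereal_scope.

Lemma measurable_pair_mfun d1 d2 (E : measurableType d1) (F : measurableType d2)
    (X : Omega -> E) (Y : Omega -> F) :
  measurable_fun setT X -> measurable_fun setT Y -> measurable_fun setT (fun w => (X w, Y w)).
Proof. by move=> mX mY; apply/measurable_fun_pairP; split. Qed.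

Lemma measurable_mfun_preimage d1 (E : measurableType d1) (X : {mfun Omega >-> E}) A :
  measurable A -> measurable (X @^-1` A).
Proof. by move=> mA; rewrite -[X in measurable X]setTI; exact: measurable_funPT. Qed.

(** Rectangles generate the product sigma-algebra, so that independence of a
    pair from an event need only be checked on them. *)
Lemma pair_event_independence d1 d2 (E : measurableType d1) (F : measurableType d2)
    (X : {mfun Omega >-> E}) (Y : {mfun Omega >-> F}) (D : set Omega) :
  measurable D ->
  (forall A B, measurable A -> measurable B ->
     P ((X @^-1` A `&` Y @^-1` B) `&` D) = P (X @^-1` A `&` Y @^-1` B) * P D) ->
  forall S, measurable S ->
     P ((fun w => (X w, Y w)) @^-1` S `&` D) = P ((fun w => (X w, Y w)) @^-1` S) * P D.
Proof.
move=> mD H S mS.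
have mXY := measurable_pair_mfun (measurable_funPT X) (measurable_funPT Y).
have PD0 : (0 <= fine (P D))%R by rewrite fine_ge0.
pose m1 := image_measure (mrestr P mD) mXY.
pose m2 := mscale (NngNum PD0) (image_measure P mXY).
pose G : set (set (E * F)) :=
  [set C | exists A, measurable A /\ exists B, measurable B /\ C = A `*` B].
have m12 C : G C -> m1 C = m2 C.
  move=> [A [mA [B [mB ->]]]].
  rewrite /m1 /m2 /= /mscale /= /image_measure /= /pushforward /mrestr /=.
  by rewrite fineK ?fin_num_measure// muleC; exact: H.
have : m1 S = m2 S.
  apply: (measure_unique G (fun=> setT)) => //.
  - rewrite measurable_prod_measurableType; congr (<<s _ >>).
    apply/seteqP; split => [C [A mA [B mB <-]]|C [A [mA [B [mB ->]]]]].
      by exists A; split => //; exists B.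
    by exists A => //; exists B.
  - move=> _ _ [X1 [mX1 [X2 [mX2 ->]]]] [Y1 [mY1 [Y2 [mY2 ->]]]].
    rewrite -setXI; exists (X1 `&` Y1); split; first exact: measurableI.
    by exists (X2 `&` Y2); split => //; exact: measurableI.
  - move=> n; exists setT; split => //; exists setT; split => //.
    by rewrite setXTT.
  - by rewrite bigcup_const//; exists 0%N.
  - move=> n; rewrite /m1 /= /image_measure /= /pushforward /mrestr /=.
    by rewrite preimage_setT setTI (le_lt_trans (probability_le1 P mD))// ltry.
rewrite /m1 /m2 /= /mscale /= /image_measure /= /pushforward /mrestr /= => ->.
by rewrite fineK ?fin_num_measure// muleC.
Qed.

(** Two measures that agree on rectangles are equal. *)
Lemma same_law_pair d1 d2 (E : measurableType d1) (F : measurableType d2)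
    (X X' : {mfun Omega >-> E}) (Y Y' : {mfun Omega >-> F}) :
  independent_pair P X Y -> independent_pair P X' Y' ->
  same_law P X X' -> same_law P Y Y' ->
  same_law P (fun w => (X w, Y w)) (fun w => (X' w, Y' w)).
Proof.
move=> XY XY' XX' YY' S mS.
have mXY := measurable_pair_mfun (measurable_funPT X) (measurable_funPT Y).
rewrite [RHS]independent_pair_law//.
apply/esym/(product_measure_unique (m' := image_measure P mXY)) => // A B mA mB.
rewrite /image_measure /= /pushforward.
by rewrite [LHS]XY// XX'// YY'.
Qed.

Lemma mutually_independent_pair d1 (E : measurableType d1) (X : nat -> {mfun Omega >-> E}) i j :
  mutually_independent P X -> i != j -> independent_pair P (X i) (X j).
Proof.
move=> Xi ij A B mA mB.
pose D k := if k == i then A else B.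
have mD k : measurable (D k) by rewrite /D; case: ifP.
have := Xi [fset i; j]%fset D mD.
rewrite big_fsetU1/= ?inE// big_seq_fset1 /D eqxx eq_sym (negbTE ij) => <-.
congr (P _); apply/seteqP; split => [w [Aw Bw] k /=|w H].
  by rewrite !inE => /orP[] /eqP ->; rewrite ?eqxx// eq_sym (negbTE ij).
split; first by have := H i; rewrite /= !inE eqxx; apply.
by have := H j; rewrite /= !inE eqxx orbT eq_sym (negbTE ij); apply.
Qed.

(** Each variable is measurable for the sigma-algebra generated by the family,
    hence so is each pair. *)
Lemma sigma_of_pair d1 (E : measurableType d1) (X : nat -> Omega -> E) i j S :
  measurable S -> sigma_of X ((fun w => (X i w, X j w)) @^-1` S).
Proof.
move=> mS.
pose G : set (set Omega) := \bigcup_i preimage_set_system setT (X i) measurable.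
have mX k : measurable_fun (T := g_sigma_algebraType G) setT (X k).
  move=> _ A mA; rewrite setTI; apply: sub_sigma_algebra.
  by exists k => //; exists A => //; rewrite setTI.
have mXX : measurable_fun (T := g_sigma_algebraType G) setT (fun w => (X i w, X j w)).
  by apply/measurable_fun_pairP; split; exact: mX.
by have := mXX measurableT S mS; rewrite setTI.
Qed.

End independence.

(** * Independence of the noises driving the model *)

Section noise.
Context d (Omega : measurableType d) (R : realType) (P : probability Omega R).

Definition mfun_of d1 (E : measurableType d1) (X : Omega -> E)
    (mX : measurable_fun setT X) : {mfun Omega >-> E} :=
  HB.pack X (isMeasurableFun.Build _ _ _ _ X mX).

Definition pair_mfun d1 d2 (E : measurableType d1) (F : measurableType d2)
    (X : {mfun Omega >-> E}) (Y : {mfun Omega >-> F}) :=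
  mfun_of (measurable_pair_mfun (measurable_funPT X) (measurable_funPT Y)).

(** The passage from rectangles to all measurable sets is made in one pair and
    then in the other. *)
Lemma independent_pair_pairs d1 d2 d3 d4 (E1 : measurableType d1) (E2 : measurableType d2)
    (F1 : measurableType d3) (F2 : measurableType d4)
    (X1 : {mfun Omega >-> E1}) (X2 : {mfun Omega >-> E2})
    (Y1 : {mfun Omega >-> F1}) (Y2 : {mfun Omega >-> F2}) :
  (forall A1 A2 B1 B2, measurable A1 -> measurable A2 -> measurable B1 -> measurable B2 ->
     (P ((X1 @^-1` A1 `&` X2 @^-1` A2) `&` (Y1 @^-1` B1 `&` Y2 @^-1` B2)) =
      P (X1 @^-1` A1 `&` X2 @^-1` A2) * P (Y1 @^-1` B1 `&` Y2 @^-1` B2))%E) ->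
  independent_pair P (pair_mfun X1 X2) (pair_mfun Y1 Y2).
Proof.
move=> H S S' mS mS'.
have mY B1 B2 : measurable B1 -> measurable B2 ->
    measurable (Y1 @^-1` B1 `&` Y2 @^-1` B2).
  by move=> m1 m2; apply: measurableI; exact: measurable_mfun_preimage.
rewrite setIC muleC; apply: (pair_event_independence (X := Y1) (Y := Y2)) => //.
  exact: measurable_mfun_preimage.
move=> B1 B2 mB1 mB2; rewrite setIC muleC.
apply: (pair_event_independence (X := X1) (Y := X2)) => //; first exact: mY.
by move=> A1 A2 mA1 mA2; exact: H.
Qed.

Lemma independent_pair_comp d1 d2 d3 d4 (E1 : measurableType d1) (E2 : measurableType d2)
    (F1 : measurableType d3) (F2 : measurableType d4)
    (X : Omega -> E1) (Y : Omega -> E2) (u : E1 -> F1) (v : E2 -> F2) :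
  measurable_fun setT u -> measurable_fun setT v ->
  independent_pair P X Y -> independent_pair P (u \o X) (v \o Y).
Proof.
move=> mu mv XY A B mA mB; apply: (XY (u @^-1` A) (v @^-1` B)).
- by rewrite -[X in measurable X]setTI; exact: mu.
- by rewrite -[X in measurable X]setTI; exact: mv.
Qed.

Lemma same_law_comp d1 d2 (E : measurableType d1) (F : measurableType d2)
    (X Y : Omega -> E) (u : E -> F) :
  measurable_fun setT u -> same_law P X Y -> same_law P (u \o X) (u \o Y).
Proof.
move=> mu XY A mA; apply: (XY (u @^-1` A)).
by rewrite -[X in measurable X]setTI; exact: mu.
Qed.

Variables (N p : nat).
Variables (eps : nat -> {mfun Omega >-> 'rV[R]_p}) (zeta : nat -> {mfun Omega >-> 'rV[R]_N}).
Variables (upsilon : 'rV[R]_p -> R) (gamma : 'rV[R]_N -> R).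
Hypotheses (eps_iid : iid_with_density P eps upsilon)
  (zeta_iid : iid_with_density P zeta gamma)
  (zeta_eps : independent_sigma P (sigma_of zeta) (sigma_of eps)).

Lemma density_same_law n (X Y : Omega -> 'rV[R]_n) (q : 'rV[R]_n -> R) :
  has_density P X q -> has_density P Y q -> same_law P X Y.
Proof. by move=> Xq Yq A mA; rewrite Xq// Yq. Qed.

(** The noises on which the transition from time k to time k.+1 depends: those of
    the two observations and that of the new state. *)
Definition step_noise k : {mfun Omega >-> ('rV[R]_p * 'rV[R]_p * 'rV[R]_N)%type} :=
  pair_mfun (pair_mfun (eps k) (eps k.+1)) (zeta k.+1).

Let eps_zeta j k l S A : measurable S -> measurable A ->
  (P (pair_mfun (eps j) (eps k) @^-1` S `&` zeta l @^-1` A) =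
   P (pair_mfun (eps j) (eps k) @^-1` S) * P (zeta l @^-1` A))%E.
Proof.
move=> mS mA; rewrite setIC muleC; apply: zeta_eps; last exact: sigma_of_pair.
have /= := sigma_of_pair (X := fun i => zeta i) l l (measurableX mA mA).
by rewrite (_ : (fun w => (zeta l w, zeta l w)) @^-1` (A `*` A) = zeta l @^-1` A)//;
  apply/seteqP; split => w; [case|].
Qed.

Lemma step_noise_same_law k : same_law P (step_noise k) (step_noise 0).
Proof.
apply: (same_law_pair (X := pair_mfun (eps k) (eps k.+1)) (X' := pair_mfun (eps 0%N) (eps 1%N))).
- by move=> S A mS mA; exact: eps_zeta.
- by move=> S A mS mA; exact: eps_zeta.
- apply: same_law_pair.
  + by apply: mutually_independent_pair; [exact: eps_iid.1|rewrite neq_ltn ltnSn].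
  + exact: mutually_independent_pair eps_iid.1 _.
  + exact: density_same_law (eps_iid.2 _) (eps_iid.2 _).
  + exact: density_same_law (eps_iid.2 _) (eps_iid.2 _).
- exact: density_same_law (zeta_iid.2 _) (zeta_iid.2 _).
Qed.

Let eps_pairs_independent j k : (j.+1 < k)%N ->
  independent_pair P (pair_mfun (eps j) (eps j.+1)) (pair_mfun (eps k) (eps k.+1)).
Proof.
move=> jk; apply: independent_pair_pairs => A1 A2 B1 B2 mA1 mA2 mB1 mB2.
have [epsI _] := eps_iid.
have epsP := mutually_independent_pair epsI.
rewrite (epsP j j.+1)// ?neq_ltn ?ltnSn// (epsP k k.+1)// ?neq_ltn ?ltnSn//.
pose D i := if i == j then A1 else if i == j.+1 then A2 else if i == k then B1 else B2.
have mD i : measurable (D i) by rewrite /D; do 3 case: ifP => // _.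
have [kj kj1 k1j k1j1] : [/\ (k == j) = false, (k == j.+1) = false,
    (k.+1 == j) = false & (k.+1 == j.+1) = false].
  by split; apply/eqP; move: jk; clear; lia.
have succ_neq i : (i.+1 == i) = false by rewrite gtn_eqF.
have j1j := succ_neq j; have k1k := succ_neq k.
have := epsI (j |` (j.+1 |` (k |` [fset k.+1])))%fset D mD.
rewrite !big_fsetU1/= ?inE ?(eq_sym j) ?(eq_sym j.+1) ?(eq_sym k) ?kj ?kj1 ?k1j ?k1j1 ?j1j ?k1k//.
rewrite big_seq_fset1 /D eqxx kj kj1 k1j k1j1 j1j k1k !eqxx !muleA => <-.
congr (P _); apply/seteqP; split => [w [[Aj Aj1] [Bk Bk1]] i /=|w H].
  by rewrite !inE => /or4P[] /eqP ->; rewrite ?eqxx ?kj ?kj1 ?k1j ?k1j1 ?j1j ?k1k ?eqxx.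
have Hj := H j; have Hj1 := H j.+1; have Hk := H k; have Hk1 := H k.+1.
rewrite /= !inE !eqxx ?orbT ?kj ?kj1 ?k1j ?k1j1 ?j1j ?k1k in Hj Hj1 Hk Hk1.
- by split; split; [exact: Hj|exact: Hj1|exact: Hk|exact: Hk1].
- by rewrite eq_sym kj1.
- by rewrite (eq_sym j) j1j (eq_sym j) kj.
Qed.

(** Consecutive steps share an observation noise; steps further apart share no
    noise. *)
Lemma step_noise_independent j k : (j.+1 < k)%N ->
  independent_pair P (step_noise j) (step_noise k).
Proof.
move=> jk; apply: independent_pair_pairs => S A S' A' mS mA mS' mA'.
rewrite !eps_zeta//.
have -> : (pair_mfun (eps j) (eps j.+1) @^-1` S `&` zeta j.+1 @^-1` A)
   `&` (pair_mfun (eps k) (eps k.+1) @^-1` S' `&` zeta k.+1 @^-1` A') =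
   (zeta j.+1 @^-1` A `&` zeta k.+1 @^-1` A') `&`
   (pair_mfun (eps j) (eps j.+1) @^-1` S `&` pair_mfun (eps k) (eps k.+1) @^-1` S').
  by rewrite [in LHS]setIACA setIC.
rewrite zeta_eps; last 2 first.
- have /= := sigma_of_pair (X := fun i => zeta i) j.+1 k.+1 (measurableX mA mA').
  by [].
- pose G : set (set Omega) := \bigcup_i preimage_set_system setT (eps i) measurable.
  by apply: (@measurableI _ (g_sigma_algebraType G)); exact: sigma_of_pair.
rewrite eps_pairs_independent// (mutually_independent_pair zeta_iid.1)//.
  by rewrite [LHS]muleC muleACA.
by rewrite eqSS neq_ltn (ltnW jk).
Qed.

(** The law of large numbers is applied to the steps of even and of odd index,
    each of these two families being pairwise independent. *)
Lemma step_noise_sum (F : 'rV[R]_p * 'rV[R]_p * 'rV[R]_N -> R) (c : R) :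
  measurable_fun setT F -> (forall v, 0 <= F v) ->
  (\int[P]_w (F (step_noise 0 w))%:E < c%:E)%E ->
  {ae P, forall w, exists n0, forall n, (n0 <= n)%N ->
    \sum_(i < n) F (step_noise i w) <= 8 * c * n%:R}.
Proof.
move=> mF F0 Fc.
have mFV i : measurable_fun setT (F \o step_noise i) by exact: measurableT_comp.
have FE i : (\int[P]_w (F (step_noise i w))%:E = \int[P]_w (F (step_noise 0 w))%:E)%E.
  apply: (same_law_integral (X := step_noise i) (Y := step_noise 0) (phi := EFin \o F)) => //.
  - exact: step_noise_same_law.
  exact/measurable_EFinP.
have law i j : same_law P (F \o step_noise i) (F \o step_noise j).
  have H l := same_law_comp mF (step_noise_same_law l).
  by move=> A mA; rewrite (H i)// (H j).
have ind i j : (i.+1 < j)%N -> independent_pair P (F \o step_noise i) (F \o step_noise j).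
  by move=> ij; apply: independent_pair_comp => //; exact: step_noise_independent.
have indC i j : (i.+1 < j)%N -> independent_pair P (F \o step_noise j) (F \o step_noise i).
  by move=> ij A B mA mB; rewrite setIC muleC; exact: ind.
have half o : {ae P, forall w, exists n0, forall n, (n0 <= n)%N ->
    \sum_(i < n) F (step_noise (o + 2 * i) w) <= 4 * c * n%:R}.
  apply: (@strong_law_upper_bound _ _ _ P (fun i => mfun_of (mFV (o + 2 * i)%N)) c) => //.
  - by move=> i w /=.
  - move=> i j ij; have [ij'|ij'|/eqP] := ltngtP i j; last by rewrite (negbTE ij).
      by apply: ind; move: ij'; clear; lia.
    by apply: indC; move: ij'; clear; lia.
  - by move=> i; exact: law.
  - by rewrite /= FE.
move: (half 0%N) (half 1%N); apply: filterS2 => w [n0 H0] [n1 H1].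
exists (maxn n0 n1) => n; rewrite geq_max => /andP[n0n n1n].
have E k : \sum_(i < 2 * k) F (step_noise i w) =
    \sum_(i < k) F (step_noise (2 * i) w) + \sum_(i < k) F (step_noise (1 + 2 * i) w).
  elim: k => [|k IH]; first by rewrite muln0 !big_ord0 addr0.
  by rewrite mulnS !add2n !big_ord_recr/= IH; ring.
apply: (@le_trans _ _ (\sum_(i < 2 * n) F (step_noise i w))).
  rewrite -!(big_mkord xpredT (fun i => F (step_noise i w))).
  rewrite (@big_cat_nat _ _ _ n 0 (2 * n))//=; last by rewrite leq_pmull.
  by rewrite lerDl sumr_ge0.
by rewrite E; have := H0 n n0n; have := H1 n n1n; rewrite /=; lra.
Qed.

End noise.

Section exceedance_frequency.
Context d (Omega : measurableType d) (R : realType) (P : probability Omega R) (n : nat).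
Variables (X : nat -> {mfun Omega >-> 'rV[R]_n}) (q : 'rV[R]_n -> R).
Hypothesis X_iid : iid_with_density P X q.

(** The events that the norm exceeds k decrease to the empty set. *)
Lemma exceedance_small (c : R) : 0 < c ->
  exists B : R, 0 <= B /\ (P [set w | (B < enorm (X 0%N w))%R] < c%:E)%E.
Proof.
move=> c0.
pose F k := [set w | (k%:R < enorm (X 0%N w))%R].
have mF k : measurable (F k).
  rewrite (_ : F k = setT `&` (@enorm R n \o X 0%N) @^-1` `]k%:R, +oo[).
    by apply: (measurableT_comp (@measurable_enorm R n) (measurable_funPT (X 0%N))).
  by rewrite setTI; apply/seteqP; split => w /=; rewrite in_itv/= andbT.
have F0 : \bigcap_k F k = set0.
  rewrite -subset0 => w Fw.
  have := Fw (Num.truncn (enorm (X 0%N w))).+1 I.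
  by rewrite /F /= ltNge (ltW (truncnS_gt _)).
have : (P \o F) k @[k --> \oo] --> P (\bigcap_k F k).
  apply: nonincreasing_cvg_mu => //.
  - by rewrite (le_lt_trans (probability_le1 _ _))// ltry.
  - by rewrite F0.
  - move=> i j ij; apply/subsetPset => w; rewrite /F /=; apply: le_lt_trans.
    by rewrite ler_nat.
rewrite F0 measure0 => PF0.
have [[k Pk]|H] := pselect (exists k, (P (F k) < c%:E)%E); first by exists k%:R; split.
suff : (c%:E <= 0)%E by rewrite lee_fin leNgt c0.
rewrite -(cvg_lim _ PF0)//; apply: lime_ge; first exact: cvgP PF0.
by apply: nearW => k; rewrite leNgt; apply/negP => Pk; apply: H; exists k.
Qed.

Lemma exceedance_frequency (B c : R) : (P [set w | (B < enorm (X 0%N w))%R] < c%:E)%E ->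
  {ae P, forall w, exists n0, forall k, (n0 <= k)%N ->
    \sum_(i < k) (B < enorm (X i w))%R%:R <= 4 * c * k%:R :> R}.
Proof.
move=> Bc.
pose u (v : 'rV[R]_n) : R := (B < enorm v)%R%:R.
have uE : u = \1_[set v | (B < enorm v)%R].
  by apply/funext => v; rewrite /u indicE; congr (nat_of_bool _)%:R; apply/idP/idP => [Bv|/set_mem//]; exact: mem_set.
have mset : measurable [set v : 'rV[R]_n | (B < enorm v)%R].
  rewrite (_ : [set _ | _] = setT `&` @enorm R n @^-1` `]B, +oo[).
    exact: measurable_enorm.
  by rewrite setTI; apply/seteqP; split => w /=; rewrite in_itv/= andbT.
have mu : measurable_fun setT u by rewrite uE; exact: measurable_indic.
have muX i : measurable_fun setT (u \o X i) by exact: measurableT_comp.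
apply: (@strong_law_upper_bound _ _ _ P (fun i => mfun_of (muX i)) c).
- by move=> i w /=; rewrite /u ler0n.
- move=> i j ij; apply: independent_pair_comp => //.
  exact: mutually_independent_pair X_iid.1 ij.
- move=> i; apply: same_law_comp => //.
  exact: density_same_law (X_iid.2 _) (X_iid.2 _).
- apply: le_lt_trans Bc; rewrite /= uE.
  rewrite (_ : [set w | _] = X 0%N @^-1` [set v | (B < enorm v)%R])//.
  rewrite -[X in (_ <= P X)%E]setIT -integral_indic//; last exact: measurable_mfun_preimage.
Qed.

End exceedance_frequency.

(** * Differences of products of integrals, total variation *)

Section antisymmetric_step.
Context d (T : measurableType d) (R : realType).

Lemma Rintegral_linear4 (mu : {measure set T -> \bar R}) (f1 f2 f3 f4 : T -> R)
    (c1 c2 c3 c4 : R) :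
  mu.-integrable setT (EFin \o f1) -> mu.-integrable setT (EFin \o f2) ->
  mu.-integrable setT (EFin \o f3) -> mu.-integrable setT (EFin \o f4) ->
  mu.-integrable setT (EFin \o (fun z => c1 * f1 z + c2 * f2 z + c3 * f3 z + c4 * f4 z)) /\
  \int[mu]_z (c1 * f1 z + c2 * f2 z + c3 * f3 z + c4 * f4 z) =
  c1 * \int[mu]_z f1 z + c2 * \int[mu]_z f2 z + c3 * \int[mu]_z f3 z + c4 * \int[mu]_z f4 z.
Proof.
move=> i1 i2 i3 i4.
have iZ c f : mu.-integrable setT (EFin \o f) ->
    mu.-integrable setT (EFin \o (fun z => c * f z)).
  by move=> fi; apply: eq_integrable (integrableZl measurableT c fi).
have iD f g : mu.-integrable setT (EFin \o f) -> mu.-integrable setT (EFin \o g) ->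
    mu.-integrable setT (EFin \o (fun z => f z + g z)).
  by move=> fi gi; apply: eq_integrable (integrableD measurableT fi gi).
have i12 := iD _ _ (iZ c1 _ i1) (iZ c2 _ i2).
have i123 := iD _ _ i12 (iZ c3 _ i3).
split; first exact: (iD _ _ i123 (iZ c4 _ i4)).
rewrite RintegralD//; last exact: iZ.
rewrite RintegralD//; last exact: iZ.
by rewrite RintegralD// ?RintegralZl//; exact: iZ.
Qed.

(** The pointwise inequality is integrated in one variable and then in the
    other; expanding the antisymmetric factor turns every double integral into
    a product of single ones. The contribution of s1 and s2 cancels when
    mu1 = mu2 and s1 = s2, which is how a symmetric part of the density of a pair
    is removed. *)
Lemma antisymmetric_step (mu1 mu2 : {measure set T -> \bar R})
    (q1 q2 s1 s2 U V : T -> R) (alpha beta : R) :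
  mu1.-integrable setT (EFin \o q1) -> mu2.-integrable setT (EFin \o q2) ->
  mu1.-integrable setT (EFin \o (q1 \* U)) -> mu1.-integrable setT (EFin \o (q1 \* V)) ->
  mu2.-integrable setT (EFin \o (q2 \* U)) -> mu2.-integrable setT (EFin \o (q2 \* V)) ->
  mu1.-integrable setT (EFin \o (s1 \* U)) -> mu1.-integrable setT (EFin \o (s1 \* V)) ->
  mu2.-integrable setT (EFin \o (s2 \* U)) -> mu2.-integrable setT (EFin \o (s2 \* V)) ->
  \int[mu1]_z q1 z = 1 -> \int[mu2]_z q2 z = 1 ->
  (forall z z', (q1 z * q2 z' - s1 z * s2 z') * (U z * V z' - V z * U z') <=
                q1 z * q2 z' * (alpha * (V z * V z') + beta)) ->
  (\int[mu1]_z (q1 z * U z)) * (\int[mu2]_z (q2 z * V z))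
    - (\int[mu1]_z (q1 z * V z)) * (\int[mu2]_z (q2 z * U z))
    - ((\int[mu1]_z (s1 z * U z)) * (\int[mu2]_z (s2 z * V z))
       - (\int[mu1]_z (s1 z * V z)) * (\int[mu2]_z (s2 z * U z)))
  <= alpha * ((\int[mu1]_z (q1 z * V z)) * (\int[mu2]_z (q2 z * V z))) + beta.
Proof.
move=> iq1 iq2 iqU1 iqV1 iqU2 iqV2 isU1 isV1 isU2 isV2 I1 I2 H.
have [Hi1 HE1] := Rintegral_linear4 (\int[mu2]_z (q2 z * V z))
  (- \int[mu2]_z (q2 z * U z)) (- \int[mu2]_z (s2 z * V z))
  (\int[mu2]_z (s2 z * U z)) iqU1 iqV1 isU1 isV1.
have [Ki1 KE1] := Rintegral_linear4 (alpha * \int[mu2]_z (q2 z * V z)) beta 0 0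
  iqV1 iq1 iq1 iq1.
have : \int[mu1]_z ((\int[mu2]_z (q2 z * V z)) * (q1 z * U z)
    + (- \int[mu2]_z (q2 z * U z)) * (q1 z * V z)
    + (- \int[mu2]_z (s2 z * V z)) * (s1 z * U z)
    + (\int[mu2]_z (s2 z * U z)) * (s1 z * V z)) <=
  \int[mu1]_z (alpha * (\int[mu2]_z (q2 z * V z)) * (q1 z * V z) + beta * q1 z
    + 0 * q1 z + 0 * q1 z).
  apply: le_Rintegral => // z _.
  have [Hi2 HE2] := Rintegral_linear4 (q1 z * U z) (- (q1 z * V z)) (- (s1 z * U z))
    (s1 z * V z) iqV2 iqU2 isV2 isU2.
  have [Ki2 KE2] := Rintegral_linear4 (alpha * (q1 z * V z)) (beta * q1 z) 0 0
    iqV2 iq2 iq2 iq2.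
  have : \int[mu2]_z' (q1 z * U z * (q2 z' * V z') + - (q1 z * V z) * (q2 z' * U z')
      + - (s1 z * U z) * (s2 z' * V z') + s1 z * V z * (s2 z' * U z')) <=
    \int[mu2]_z' (alpha * (q1 z * V z) * (q2 z' * V z') + beta * q1 z * q2 z'
      + 0 * q2 z' + 0 * q2 z').
    by apply: le_Rintegral => // z' _; have := H z z'; nra.
  rewrite [leLHS]HE2 [leRHS]KE2 I2; nra.
rewrite [leLHS]HE1 [leRHS]KE1 I1; nra.
Qed.

End antisymmetric_step.

Section total_variation_bound.
Context d (T : measurableType d) (R : realType) (mu : set T -> R).
Hypothesis mu_add : forall A B, measurable A -> measurable B -> A `&` B = set0 ->
  mu (A `|` B) = mu A + mu B.

Let mu0 : mu set0 = 0.
Proof.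
have := mu_add measurable0 measurable0 (setI0 set0).
by rewrite setU0 => H; lra.
Qed.

Lemma additive_bigsetU k (A : 'I_k -> set T) (Q : pred 'I_k) :
  (forall i, measurable (A i)) -> trivIset setT A ->
  measurable (\bigcup_(i in [set i | Q i]) A i) /\
  mu (\bigcup_(i in [set i | Q i]) A i) = \sum_(i < k | Q i) mu (A i).
Proof.
move=> mA tA.
have H (s : seq 'I_k) : uniq s -> measurable (\big[setU/set0]_(i <- s | Q i) A i) /\
    mu (\big[setU/set0]_(i <- s | Q i) A i) = \sum_(i <- s | Q i) mu (A i).
  elim: s => [|i s IH]; first by rewrite !big_nil mu0; split.
  move=> /= /andP[i_s us]; have [mU muU] := IH us; rewrite !big_cons.
  case: ifPn => // Qi; split; first exact: measurableU.
  rewrite mu_add// ?muU// -subset0 => x [] Aix.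
  rewrite -bigcup_seq_cond => -[j /= /andP[js _] Ajx].
  have ij : i = j by apply: (tA i j) => //; exists x.
  by move: i_s; rewrite ij js.
have -> : \bigcup_(i in [set i | Q i]) A i = \big[setU/set0]_(i <- enum 'I_k | Q i) A i.
  rewrite -bigcup_seq_cond; apply/seteqP; split => x [i /= Qi Aix]; exists i => //=.
    by rewrite mem_enum.
  by case/andP : Qi.
by have [h1 h2] := H _ (enum_uniq 'I_k); split => //; rewrite h2 big_enum_cond.
Qed.

(** The pieces of a partition where mu is nonnegative, and those where it is
    negative, are merged into two sets. *)
Lemma tv_norm_le (delta : R) : (forall A, measurable A -> `|mu A| <= delta) ->
  (tv_norm mu <= (2 * delta)%:E)%E.
Proof.
move=> mud; apply: ge_ereal_sup => _ [k [A [mA tA _ ->]]]; rewrite lee_fin.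
rewrite (bigID (fun i => 0 <= mu (A i)))/= mulr_natl mulr2n lerD//.
  have [m1 e1] := additive_bigsetU (fun i => 0 <= mu (A i)) mA tA.
  rewrite (le_trans _ (mud _ m1))// (le_trans _ (ler_norm _))// e1.
  by apply: ler_sum => i i0; rewrite ger0_norm.
have [m1 e1] := additive_bigsetU (fun i => ~~ (0 <= mu (A i))) mA tA.
rewrite (le_trans _ (mud _ m1))// -normrN (le_trans _ (ler_norm _))// e1 -sumrN.
by apply: ler_sum => i; rewrite -ltNge => i0; rewrite ltr0_norm.
Qed.

End total_variation_bound.

(** * The filter and its contraction *)

Section filter.
Context (R : realType) (N p : nat).
Local Notation X := 'rV[R]_N.
Local Notation Y := 'rV[R]_p.
Local Notation lam := (@lebesgue_rV R N).
Variables (f : X -> X) (h : X -> Y) (upsilon : Y -> R) (gamma : X -> R) (M : R).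
Hypotheses (mf : measurable_fun setT f) (mh : measurable_fun setT h).
Hypotheses (mupsilon : measurable_fun setT upsilon) (mgamma : measurable_fun setT gamma).
Hypotheses (upsilon_gt0 : forall u, 0 < upsilon u) (gamma_gt0 : forall s, 0 < gamma s).
Hypothesis gamma_int : (\int[lam]_z (gamma z)%:E = 1)%E.
Hypothesis upsilon_le : forall u, upsilon u <= M.

Local Notation q := (fun x z => gamma (z - f x)).
Local Notation g := (likelihood h upsilon).

Lemma likelihood_gt0 x y : 0 < g x y. Proof. exact: upsilon_gt0. Qed.

Lemma likelihood_le x y : g x y <= M. Proof. exact: upsilon_le. Qed.

Lemma measurable_likelihood y : measurable_fun setT (g ^~ y).
Proof.
apply: (measurableT_comp mupsilon); apply: measurable_fun_rVB => //.
Qed.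

Lemma measurable_transition_density x : measurable_fun setT (q x).
Proof. by apply: (measurableT_comp mgamma); exact: measurable_fun_rVB. Qed.

Lemma measurable_transition_density2 :
  measurable_fun setT (fun xz : X * X => q xz.1 xz.2).
Proof.
apply: (measurableT_comp mgamma); apply: measurable_fun_rVB => //.
exact: (measurableT_comp mf measurable_fst).
Qed.

Lemma integral_transition_density x : (\int[lam]_z (q x z)%:E = 1)%E.
Proof.
rewrite -gamma_int (ge0_integral_lebesgue_rV_translation (- f x) (F := EFin \o gamma))//.
- exact/measurable_EFinP.
- by move=> z; rewrite /= lee_fin ltW.
Qed.

Section transition_measure.
Variable x : X.
Local Open Scope ereal_scope.

Let transition0 : transition f gamma x set0 = 0.
Proof. by rewrite /transition integral_set0. Qed.

Let transition_ge0 A : 0 <= transition f gamma x A.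
Proof. by apply: integral_ge0 => z _; rewrite lee_fin ltW. Qed.

Let transition_sigma_additive : semi_sigma_additive (transition f gamma x).
Proof.
move=> F mF tF mUF; rewrite /transition ge0_integral_bigcup//.
- apply: is_cvg_ereal_nneg_natsum_cond => n _ _.
  by apply: integral_ge0 => z _; rewrite lee_fin ltW.
- apply/measurable_EFinP; apply: measurable_funTS.
  exact: measurable_transition_density.
- by move=> z _; rewrite lee_fin ltW.
Qed.

HB.instance Definition _ := isMeasure.Build _ _ _ (transition f gamma x)
  transition0 transition_ge0 transition_sigma_additive.

Lemma integral_transition (F : X -> \bar R) :
  measurable_fun setT F -> (forall z, 0 <= F z) ->
  \int[transition f gamma x]_z F z = \int[lam]_z ((q x z)%:E * F z).
Proof.
move=> mF F0; apply: ge0_integral_density => //.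
- exact: measurable_transition_density.
- by move=> z; rewrite ltW.
Qed.

End transition_measure.

Variable y : nat -> Y.
Local Notation pe := (path_integral f h upsilon gamma y).

Let M_gt0 : 0 < M. Proof. exact: lt_le_trans (upsilon_gt0 0) (upsilon_le 0). Qed.

Lemma path_integral_spec n : forall k A, measurable A ->
  measurable_fun setT (pe k n A) /\ (forall x, 0 <= pe k n A x <= (M ^+ n)%:E)%E.
Proof.
elim: n => [|n IH] k A mA.
  rewrite /=; split; first by apply/measurable_EFinP; exact: measurable_indic.
  by move=> x; rewrite !lee_fin expr0 indicE; case: (x \in A) => /=; rewrite ?lexx ler01.
have [mp p01] := IH k.+1 A mA.
have p0 x : (0 <= pe k.+1 n A x)%E by have /andP[] := p01 x.
have mF : measurable_fun setT (fun x' => (g x' (y k.+1))%:E * pe k.+1 n A x')%E.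
  by apply: emeasurable_funM => //; apply/measurable_EFinP; exact: measurable_likelihood.
have F0 x' : (0 <= (g x' (y k.+1))%:E * pe k.+1 n A x')%E.
  by rewrite mule_ge0// lee_fin ltW// likelihood_gt0.
rewrite (_ : pe k n.+1 A = fun x => \int[lam]_z ((q x z)%:E *
    ((g z (y k.+1))%:E * pe k.+1 n A z)))%E; last first.
  by apply/funext => x; rewrite /= integral_transition.
split.
  apply: (measurable_fun_fubini_tonelli_F (m2 := lam)
    (fun xz : X * X => (q xz.1 xz.2)%:E * ((g xz.2 (y k.+1))%:E * pe k.+1 n A xz.2))%E).
  - apply: emeasurable_funM.
      by apply/measurable_EFinP; exact: measurable_transition_density2.
    exact: (measurableT_comp mF measurable_snd).
  - by move=> xz; rewrite mule_ge0// lee_fin ltW.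
move=> x; apply/andP; split.
  by apply: integral_ge0 => z _; rewrite mule_ge0// lee_fin ltW.
rewrite -[leRHS]mule1 -(integral_transition_density x) -ge0_integralZl//; last 3 first.
- by apply/measurable_EFinP; exact: measurable_transition_density.
- by move=> z _; rewrite lee_fin ltW.
- by rewrite lee_fin exprn_ge0// ltW.
apply: ge0_le_integral => //.
- by move=> z _; rewrite mule_ge0// lee_fin ltW.
- apply: emeasurable_funM => //.
  by apply/measurable_EFinP; exact: measurable_transition_density.
- apply: emeasurable_funM => //.
  by apply/measurable_EFinP; exact: measurable_transition_density.
- move=> z _; rewrite muleC; apply: lee_wpmul2r; first by rewrite lee_fin ltW.
  rewrite exprS EFinM.
  apply: lee_pmul => //; first by rewrite lee_fin ltW// likelihood_gt0.
    by rewrite lee_fin likelihood_le.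
  by have /andP[] := p01 z.
Qed.

(** All path integrals are finite, since the likelihood is bounded; from here on
    they are real numbers. *)
Definition path_weight k n A x : R := fine (pe k n A x).
Local Notation pw := path_weight.

Lemma path_weightE k n A x : measurable A -> pe k n A x = (pw k n A x)%:E.
Proof.
move=> mA; rewrite fineK// ge0_fin_numE; have /andP[p0 p1] := (path_integral_spec n k mA).2 x => //.
exact: le_lt_trans p1 (ltry _).
Qed.

Lemma path_weight_ge0 k n A x : measurable A -> 0 <= pw k n A x.
Proof.
by move=> mA; rewrite -lee_fin -path_weightE//; have /andP[] := (path_integral_spec n k mA).2 x.
Qed.

Lemma path_weight_le k n A x : measurable A -> pw k n A x <= M ^+ n.
Proof.
by move=> mA; rewrite -lee_fin -path_weightE//; have /andP[] := (path_integral_spec n k mA).2 x.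
Qed.

Lemma measurable_path_weight k n A : measurable A -> measurable_fun setT (pw k n A).
Proof.
move=> mA; apply/measurable_EFinP; rewrite (_ : EFin \o _ = pe k n A).
  exact: (path_integral_spec n k mA).1.
by apply/funext => x /=; rewrite path_weightE.
Qed.

Lemma path_weight_step_integrable (mu : {measure set X -> \bar R}) (r : X -> R) k n A :
  measurable A -> mu.-integrable setT (EFin \o r) ->
  mu.-integrable setT (EFin \o (r \* (fun z => g z (y k) * pw k n A z))).
Proof.
move=> mA ri; apply: (le_integrable measurableT _ _ (integrableZl measurableT (M * M ^+ n) ri)).
  apply/measurable_EFinP; apply: measurable_funM.
    by apply/measurable_EFinP; exact: measurable_int ri.
  by apply: measurable_funM; [exact: measurable_likelihood|exact: measurable_path_weight].
move=> x _ /=; rewrite lee_fin !normrM [leLHS]mulrC ler_wpM2r//.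
rewrite -normrM !ger0_norm ?mulr_ge0 ?exprn_ge0 ?path_weight_ge0 ?(ltW (likelihood_gt0 _ _))// ?(ltW M_gt0)//.
apply: ler_pM; [exact: ltW (likelihood_gt0 _ _)|exact: path_weight_ge0|exact: likelihood_le|exact: path_weight_le].
Qed.

Lemma transition_density_integrable x : lam.-integrable setT (EFin \o q x).
Proof.
apply/integrableP; split.
  by apply/measurable_EFinP; exact: measurable_transition_density.
rewrite (eq_integral (fun z => (q x z)%:E)); last first.
  by move=> z _ /=; rewrite ger0_norm// ltW.
by rewrite integral_transition_density ltry.
Qed.

Lemma Rintegral_transition_density x : \int[lam]_z q x z = 1.
Proof. by rewrite /Rintegral integral_transition_density. Qed.

Lemma path_weightS k n A x : measurable A ->
  pw k n.+1 A x = \int[lam]_z (q x z * (g z (y k.+1) * pw k.+1 n A z)).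
Proof.
move=> mA; have [mp p0] := path_integral_spec n k.+1 mA.
rewrite /path_weight /Rintegral /= integral_transition//.
- by congr fine; apply: eq_integral => z _; rewrite !EFinM -path_weightE.
- by apply: emeasurable_funM => //; apply/measurable_EFinP; exact: measurable_likelihood.
- move=> z; apply: mule_ge0; last by have /andP[] := p0 z.
  by rewrite lee_fin ltW// likelihood_gt0.
Qed.

Lemma path_weight_le_total k n A x : measurable A -> pw k n A x <= pw k n setT x.
Proof.
elim: n k x => [|n IH] k x mA.
  by rewrite /path_weight /= !indicE in_setT; case: (x \in A).
rewrite !path_weightS//; apply: le_Rintegral => //.
- by apply: path_weight_step_integrable => //; exact: transition_density_integrable.
- by apply: path_weight_step_integrable => //; exact: transition_density_integrable.
- move=> z _; apply: ler_wpM2l; first exact: ltW.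
  by apply: ler_wpM2l; [exact: ltW (likelihood_gt0 _ _)|exact: IH].
Qed.

Lemma path_weightU k n A B x : measurable A -> measurable B -> A `&` B = set0 ->
  pw k n (A `|` B) x = pw k n A x + pw k n B x.
Proof.
move=> mA mB AB; elim: n k x => [|n IH] k x.
  rewrite /path_weight /= !indicE in_setU.
  have [xA|xA] := boolP (x \in A); have [xB|xB] := boolP (x \in B);
    rewrite ?addr0 ?add0r//.
  have : (A `&` B) x by split; exact: set_mem.
  by rewrite AB.
rewrite !path_weightS//; last exact: measurableU.
rewrite -RintegralD//.
- by apply: eq_Rintegral => z _; rewrite IH; ring.
- by apply: path_weight_step_integrable => //; exact: transition_density_integrable.
- by apply: path_weight_step_integrable => //; exact: transition_density_integrable.
Qed.

Section contraction.
Variables (C : nat -> set X) (good : pred nat) (e e' eta : R).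
Hypothesis mC : forall k, measurable (C k).
Hypotheses (e_gt0 : 0 < e) (e_le : e <= e').
Hypothesis good_density : forall k x z, good k.+1 -> C k x -> C k.+1 z ->
  e <= q x z <= e'.
Hypothesis eta_gt0 : 0 < eta.
Hypothesis eta_out : forall k x, ~ C k x -> g x (y k) <= eta.

Let theta : R := 1 - (e / e') ^+ 2.

Let ee'_itv : 0 <= (e / e') ^+ 2 <= 1.
Proof.
have e'0 : 0 < e' by exact: lt_le_trans e_le.
rewrite sqr_ge0/= expr_le1 ?divr_ge0 ?(ltW e_gt0) ?(ltW e'0)//.
by rewrite ler_pdivrMr// mul1r.
Qed.

Let theta_ge0 : 0 <= theta.
Proof. by have /andP[_] := ee'_itv; rewrite /theta; lra. Qed.

Let theta_le1 : theta <= 1.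
Proof. by have /andP[+ _] := ee'_itv; rewrite /theta; lra. Qed.

Definition outside k x x' : bool := ~~ ((x \in C k) && (x' \in C k)).

Let likelihood_outside k z z' : outside k z z' ->
  g z (y k) * g z' (y k) <= eta * M.
Proof.
have g0 x := ltW (likelihood_gt0 x (y k)).
rewrite /outside negb_and => /orP[|] /negP zC.
  by apply: ler_pM => //; [apply: eta_out => /mem_set|exact: likelihood_le].
rewrite mulrC; apply: ler_pM => //; last exact: likelihood_le.
by apply: eta_out => /mem_set.
Qed.

(** At a good time, the part of the transition density that is common to all
    starting points in C k. *)
Let common k x x' : X -> R :=
  if good k.+1 && ~~ outside k x x' then fun z => e * \1_(C k.+1) z else cst 0.

Let common_integrable k x x' : lam.-integrable setT (EFin \o common k x x').
Proof.
rewrite /common; case: ifPn => [/andP[gk]|_]; last exact: integrable0.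
rewrite /outside negbK => /andP[/set_mem xC _].
apply: (le_integrable measurableT _ _ (transition_density_integrable x)).
  by apply/measurable_EFinP; apply: measurable_funM.
move=> z _ /=; rewrite lee_fin (ger0_norm (ltW (gamma_gt0 _))) indicE.
have [/set_mem zC|_] := boolP (z \in C k.+1).
  by rewrite mulr1 (ger0_norm (ltW e_gt0)); have /andP[] := good_density gk xC zC.
by rewrite mulr0 normr0 ltW.
Qed.

(** Where both endpoints lie in the sets C, removing the common part leaves at
    most a fraction theta of the density, because (e / e') ^ 2 of it is at most
    e ^ 2. *)
Let residual_density k x x' z z' :
  0 <= q x z * q x' z' - common k x x' z * common k x x' z' <=
  (if [&& good k.+1, ~~ outside k x x' & ~~ outside k.+1 z z'] then theta else 1)
  * (q x z * q x' z').
Proof.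
have q0 u v : 0 < q u v by exact: gamma_gt0.
have qq0 : 0 < q x z * q x' z' by rewrite mulr_gt0.
rewrite /common; case: ifPn => [/andP[gk xx']|]; last first.
  rewrite andbA => /negbTE ->/=.
  by rewrite mulr0 subr0 mul1r lexx ltW.
rewrite gk xx'/= !indicE /outside negbK.
have [/set_mem zC|_] := boolP (z \in C k.+1); last first.
  by rewrite /= mulr0 mul0r subr0 mul1r lexx ltW.
have [/set_mem zC'|_] := boolP (z' \in C k.+1); last first.
  by rewrite /= !mulr0 subr0 mul1r lexx ltW.
move: xx'; rewrite /outside negbK => /andP[/set_mem xC /set_mem xC'] /=.
have /andP[q1 q2] := good_density gk xC zC.
have /andP[q1' q2'] := good_density gk xC' zC'.
have e'0 : 0 < e' by exact: lt_le_trans e_le.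
rewrite !mulr1 subr_ge0 ler_pM ?(ltW e_gt0)//=.
rewrite /theta mulrBl mul1r lerD2l lerN2.
rewrite expr_div_n mulrAC ler_pdivrMr ?exprn_gt0//.
by rewrite -expr2 ler_wpM2l ?sqr_ge0// expr2 ler_pM// ltW.
Qed.

(** Either the pair leaves the sets C at least m times, and each exit replaces a
    factor M ^ 2 by eta M; or it leaves them less often, each exit spoiling at
    most two transitions, and all the other good times contract by theta. The
    induction on the number of steps is on the statement for all budgets m, one
    unit of which is spent at each exit. *)
Lemma path_weight_contraction n : forall k m A x x', measurable A ->
  pw k n A x * pw k n setT x' - pw k n setT x * pw k n A x' <=
  theta ^+ (count good (iota k.+1 n) - (2 * m + outside k x x'))
    * (pw k n setT x * pw k n setT x')
  + (eta / M) ^+ m * M ^+ (2 * n).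
Proof.
have v0 k n' x : 0 <= pw k n' setT x by exact: path_weight_ge0.
have r0 : 0 <= eta / M by rewrite divr_ge0// ltW.
have M0 := ltW M_gt0.
have crude n' k' A' u u' : measurable A' ->
    pw k' n' A' u * pw k' n' setT u' - pw k' n' setT u * pw k' n' A' u' <=
    pw k' n' setT u * pw k' n' setT u'.
  move=> mA'; apply: (@le_trans _ _ (pw k' n' A' u * pw k' n' setT u')).
    by rewrite gerBl mulr_ge0// path_weight_ge0.
  by rewrite ler_wpM2r// path_weight_le_total.
elim: n => [|n IH] k m A x x' mA.
  rewrite sub0n expr0 mul1r (le_trans (crude _ _ _ _ _ mA))//.
  by rewrite lerDl mulr_ge0 ?exprn_ge0.
case: m => [|m].
  rewrite (le_trans (crude _ _ _ _ _ mA))//.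
  apply: (@le_trans _ _ (M ^+ (2 * n.+1))).
    by rewrite mul2n -addnn exprD ler_pM// path_weight_le.
  by rewrite expr0 mul1r lerDr !mulr_ge0 ?exprn_ge0.
set al := theta ^+ _; set be := _ * M ^+ _.
have al0 : 0 <= al by rewrite exprn_ge0.
pose s := common k x x'.
have iU r B : measurable B -> lam.-integrable setT (EFin \o r) ->
    lam.-integrable setT (EFin \o (r \* (fun z => g z (y k.+1) * pw k.+1 n B z))).
  by move=> mB; exact: path_weight_step_integrable.
have iq := transition_density_integrable.
have is_ : lam.-integrable setT (EFin \o s) by exact: common_integrable.
have := antisymmetric_step (mu1 := lam) (mu2 := lam) (q1 := q x) (q2 := q x')
  (s1 := s) (s2 := s) (U := fun z => g z (y k.+1) * pw k.+1 n A z)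
  (V := fun z => g z (y k.+1) * pw k.+1 n setT z) (alpha := al) (beta := be)
  (iq x) (iq x') (iU _ _ mA (iq x)) (iU _ _ measurableT (iq x))
  (iU _ _ mA (iq x')) (iU _ _ measurableT (iq x'))
  (iU _ _ mA is_) (iU _ _ measurableT is_) (iU _ _ mA is_) (iU _ _ measurableT is_)
  (Rintegral_transition_density x) (Rintegral_transition_density x').
rewrite !path_weightS//.
set D := (X in X - _ <= _).
rewrite [X in D - X](_ : _ = 0) ?subr0; last by rewrite mulrC subrr.
apply => z z'.
set gz := g z _; set gz' := g z' _.
have gz0 : 0 < gz := likelihood_gt0 _ _; have gz'0 : 0 < gz' := likelihood_gt0 _ _.
rewrite (_ : gz * _ * _ - _ = gz * gz' * (pw k.+1 n A z * pw k.+1 n setT z'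
   - pw k.+1 n setT z * pw k.+1 n A z')); last by ring.
have /andP[d0 d1] := residual_density k x x' z z'.
set tau := (X in _ <= X * _) in d1.
have tau0 : 0 <= tau <= 1 by rewrite /tau; case: ifP; rewrite ?theta_ge0 ?ler01 ?lexx.
set vv := pw k.+1 n setT z * pw k.+1 n setT z'.
have vv0 : 0 <= vv by rewrite mulr_ge0.
have gg0 : 0 < gz * gz' by rewrite mulr_gt0.
(* An exit at time k.+1 is paid for with one unit of the budget. *)
pose m' := (m.+1 - outside k.+1 z z')%N.
pose al' := theta ^+ (count good (iota k.+2 n) - (2 * m' + outside k.+1 z z')).
pose be' := (eta / M) ^+ m' * M ^+ (2 * n).
have B0 : 0 <= al' * vv + be' by rewrite addr_ge0// !mulr_ge0// exprn_ge0.
apply: (@le_trans _ _ (tau * (q x z * q x' z') * (gz * gz' * (al' * vv + be')))).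
  apply: (@le_trans _ _ ((q x z * q x' z' - s z * s z') * (gz * gz' * (al' * vv + be')))).
    by rewrite ler_wpM2l// ler_wpM2l ?(ltW gg0)//; exact: IH.
  by rewrite ler_wpM2r// mulr_ge0// ltW.
rewrite mulrAC mulrA [leLHS]mulrC -mulrA.
apply: ler_wpM2l; first by rewrite ltW// mulr_gt0// gamma_gt0.
have tal : tau * al' <= al.
  rewrite /tau /al' /al /= /m'; move: (count good (iota k.+2 n)) => K.
  case: ifPn => [/and3P[gk /negbTE -> /negbTE ->]|].
    rewrite gk /= -exprS ler_wiXn2l//.
    by move: K (m); clear => K j; lia.
  have [oz _|oz] := boolP (outside k.+1 z z').
    rewrite mul1r ler_wiXn2l//.
    by move: K (m) (good k.+1) (outside k x x'); clear => K j [] []; lia.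
  rewrite andbT negb_and negbK => /orP[/negbTE ->|->]; rewrite mul1r ler_wiXn2l//=.
  - by move: K (m) (outside k x x'); clear => K j []; lia.
  - by move: K (m) (good k.+1); clear => K j []; lia.
have gbe : gz * gz' * be' <= be.
  rewrite /be /be' /m' (_ : M ^+ (2 * n.+1) = M ^+ 2 * M ^+ (2 * n)); last first.
    by rewrite -exprD mulnS.
  have [oz|oz] := boolP (outside k.+1 z z').
    rewrite subn1/= exprS.
    apply: (@le_trans _ _ (eta * M * ((eta / M) ^+ m * M ^+ (2 * n)))).
      by rewrite ler_wpM2r ?likelihood_outside// mulr_ge0 ?exprn_ge0.
    rewrite le_eqVlt; apply/orP; left; apply/eqP.
    by field; rewrite gt_eqF.
  rewrite subn0 mulrCA ler_wpM2l ?exprn_ge0// ler_wpM2r ?exprn_ge0//.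
  by rewrite expr2 ler_pM ?(ltW gz0) ?(ltW gz'0)// likelihood_le.
have /andP[t0 t1] := tau0.
have be'0 : 0 <= gz * gz' * be' by rewrite !mulr_ge0 ?(ltW gz0) ?(ltW gz'0)// exprn_ge0.
rewrite (_ : tau * _ = gz * gz' * vv * (tau * al') + tau * (gz * gz' * be')); last by ring.
rewrite lerD//.
  rewrite [leRHS](_ : _ = gz * gz' * vv * al); last by rewrite /vv; ring.
  by rewrite ler_wpM2l// mulr_ge0// ltW.
by rewrite (le_trans _ gbe)// ler_piMl.
Qed.

End contraction.

Let integrable_mulr (mu : {measure set X -> \bar R}) (F : X -> R) (c : R) :
  mu.-integrable setT (EFin \o F) -> mu.-integrable setT (EFin \o (fun z => F z * c)).
Proof. by move=> Fi; apply: eq_integrable (integrableZr measurableT c Fi). Qed.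

Definition filter_weight (nu : set X -> \bar R) n A : R :=
  fine (unnormalized_filter f h upsilon gamma nu n y A).
Local Notation fw := filter_weight.

Section initial_law.
Variable nu : probability X R.

Let integrable1 : nu.-integrable setT (EFin \o (cst 1 : X -> R)).
Proof. exact: finite_measure_integrable_cst. Qed.

Let weight_integrable n A : measurable A ->
  nu.-integrable setT (EFin \o (fun x => g x (y 0%N) * pw 0 n A x)).
Proof.
move=> mA; have := path_weight_step_integrable 0 n mA integrable1.
by apply: eq_integrable => // x _ /=; rewrite mul1r.
Qed.

Lemma filter_weightE n A : measurable A ->
  fw nu n A = \int[nu]_x (g x (y 0%N) * pw 0 n A x).
Proof.
move=> mA; rewrite /filter_weight /unnormalized_filter /Rintegral.
by congr fine; apply: eq_integral => x _; rewrite path_weightE.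
Qed.

Lemma filter_weight_ge0 n A : measurable A -> 0 <= fw nu n A.
Proof.
move=> mA; rewrite filter_weightE//; apply: Rintegral_ge0 => x _.
by rewrite mulr_ge0 ?path_weight_ge0// ltW// likelihood_gt0.
Qed.

Lemma filter_weightU n A B : measurable A -> measurable B -> A `&` B = set0 ->
  fw nu n (A `|` B) = fw nu n A + fw nu n B.
Proof.
move=> mA mB AB; rewrite !filter_weightE//; last exact: measurableU.
rewrite -RintegralD//; [|exact: weight_integrable|exact: weight_integrable].
by apply: eq_Rintegral => x _; rewrite path_weightU// mulrDr.
Qed.

(** The signal is restricted to the sets L k from time 1 on. The time 0, where
    the initial law is arbitrary, only enters through the constant factor. *)
Lemma filter_weight_lower (L : nat -> set X) (l : nat -> R) n :
  (forall k, measurable (L k)) -> (forall k, 0 <= l k) ->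
  (forall k x, L k.+1 x -> l k.+2 <= pw k.+1 1 (L k.+2) x) ->
  fw nu 1 (L 1%N) * \prod_(i <- iota 2 n) l i <= fw nu n.+1 setT.
Proof.
move=> mL l0 lL.
have step k j x : (forall z, L k.+1 z ->
      \prod_(i <- iota k.+2 j) l i <= pw k.+1 j setT z) ->
    pw k 1 (L k.+1) x * \prod_(i <- iota k.+2 j) l i <= pw k j.+1 setT x.
  move=> H; rewrite !path_weightS// -RintegralZr//; last first.
    by apply: path_weight_step_integrable => //; exact: transition_density_integrable.
  apply: le_Rintegral => //.
  - apply: integrable_mulr.
    exact: (path_weight_step_integrable k.+1 0 (mL k.+1) (transition_density_integrable x)).
  - by apply: path_weight_step_integrable => //; exact: transition_density_integrable.
  move=> z _; rewrite -2!mulrA; apply: ler_wpM2l; first exact: ltW.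
  apply: ler_wpM2l; first exact: ltW (likelihood_gt0 _ _).
  rewrite /path_weight /= indicE.
  have [/set_mem /H Lz|_] := boolP (z \in L k.+1); first by rewrite mul1r.
  by rewrite mul0r; exact: path_weight_ge0.
have lower j : forall k x, L k.+1 x -> \prod_(i <- iota k.+2 j) l i <= pw k.+1 j setT x.
  elim: j => [|j IH] k x Lx.
    by rewrite big_nil /path_weight /= indicE in_setT.
  rewrite /= big_cons; apply: le_trans (step k.+1 j x (IH k.+1)).
  by apply: ler_wpM2r; [exact: prodr_ge0|exact: lL].
rewrite !filter_weightE// -RintegralZr//; last exact: weight_integrable.
apply: le_Rintegral => //.
- by apply: integrable_mulr; exact: weight_integrable.
- exact: weight_integrable.
move=> x _; rewrite -mulrA; apply: ler_wpM2l; first exact: ltW (likelihood_gt0 _ _).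
by apply: step; exact: lower.
Qed.

Lemma path_weight1_gt0 k A x : measurable A -> (0 < lam A)%E -> 0 < pw k 1 A x.
Proof.
move=> mA lamA; rewrite -lte_fin -path_weightE//= integral_transition//; last 2 first.
- apply: emeasurable_funM; apply/measurable_EFinP; last exact: measurable_indic.
  exact: measurable_likelihood.
- by move=> z; rewrite lee_fin mulr_ge0 ?ler0n// ltW// likelihood_gt0.
rewrite (_ : (\int[_]_z _)%E = (\int[lam]_(z in A) (q x z * g z (y k.+1))%:E)%E); last first.
  rewrite [RHS]integral_mkcond; apply: eq_integral => z _.
  rewrite patchE indicE; case: (z \in A) => /=.
    by rewrite mule1 EFinM.
  by rewrite !mule0.
apply: integral_pos_gt0 => //.
- apply: measurable_funTS; apply: measurable_funM; last exact: measurable_likelihood.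
  exact: measurable_transition_density.
- by move=> z _; rewrite mulr_gt0// likelihood_gt0.
Qed.

Lemma path_weight1_lower k A x (c v : R) : measurable A -> 0 <= c ->
  (forall z, A z -> c <= q x z * g z (y k.+1)) -> (v%:E <= lam A)%E ->
  c * v <= pw k 1 A x.
Proof.
move=> mA c0 cq vA; rewrite -lee_fin -path_weightE//= integral_transition//; last 2 first.
- apply: emeasurable_funM; apply/measurable_EFinP; last exact: measurable_indic.
  exact: measurable_likelihood.
- by move=> z; rewrite lee_fin mulr_ge0 ?ler0n// ltW// likelihood_gt0.
apply: (@le_trans _ _ (c%:E * lam A)%E); first by rewrite EFinM lee_wpmul2l.
rewrite -[A in lam A]setIT -integral_indic// -ge0_integralZl//; last first.
  exact/measurable_EFinP.
apply: ge0_le_integral => //.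
- by move=> z _; rewrite -EFinM lee_fin mulr_ge0.
- by apply: emeasurable_funM => //; exact/measurable_EFinP.
- apply: emeasurable_funM; apply/measurable_EFinP; first exact: measurable_transition_density.
  by apply: measurable_funM; [exact: measurable_likelihood|exact: measurable_indic].
- move=> z _; rewrite -!EFinM lee_fin mulrA indicE.
  have [/set_mem zA|_] := boolP (z \in A); last by rewrite !mulr0.
  by rewrite !mulr1 cq.
Qed.

Lemma filter_weight1_gt0 A : measurable A -> (0 < lam A)%E -> 0 < fw nu 1 A.
Proof.
move=> mA lamA; rewrite filter_weightE// fine_gt0//; apply/andP; split.
  apply: integral_pos_gt0 => //.
  - by apply: measurable_funM; [exact: measurable_likelihood|exact: measurable_path_weight].
  - by move=> x _; rewrite mulr_gt0 ?likelihood_gt0// path_weight1_gt0.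
  - by rewrite /= probability_setT.
by apply: integrable_lty => //; exact: weight_integrable.
Qed.

End initial_law.

Lemma filtering_additive (nu : probability X R) n A B :
  measurable A -> measurable B -> A `&` B = set0 ->
  filtering f h upsilon gamma nu n y (A `|` B) =
  filtering f h upsilon gamma nu n y A + filtering f h upsilon gamma nu n y B.
Proof.
move=> mA mB AB; rewrite /filtering -mulrDl; congr (_ / _).
exact: filter_weightU.
Qed.

Section filtering_contraction.
Variables (nu nu' : probability X R).
Variables (C : nat -> set X) (good : pred nat) (e e' eta : R).
Hypothesis mC : forall k, measurable (C k).
Hypotheses (e_gt0 : 0 < e) (e_le : e <= e').
Hypothesis good_density : forall k x z, good k.+1 -> C k x -> C k.+1 z ->
  e <= q x z <= e'.
Hypothesis eta_gt0 : 0 < eta.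
Hypothesis eta_out : forall k x, ~ C k x -> g x (y k) <= eta.

(** The initial laws are treated like one more step, without any common part;
    being possibly outside of C 0 at time 0 costs one good time. *)
Lemma filtering_contraction n m A : measurable A ->
  0 < fw nu n setT -> 0 < fw nu' n setT ->
  filtering f h upsilon gamma nu n y A - filtering f h upsilon gamma nu' n y A <=
  (1 - (e / e') ^+ 2) ^+ (count good (iota 1 n) - (2 * m).+1)
  + M ^+ 2 * ((eta / M) ^+ m * M ^+ (2 * n)) / (fw nu n setT * fw nu' n setT).
Proof.
move=> mA L0 L0'.
have int1 (mu : probability X R) : mu.-integrable setT (EFin \o (cst 1 : X -> R)).
  exact: finite_measure_integrable_cst.
have int0 (mu : probability X R) : mu.-integrable setT (EFin \o (cst 0 : X -> R)).
  exact: finite_measure_integrable_cst.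
have I1 (mu : probability X R) : \int[mu]_x (cst 1 x : R) = 1.
  transitivity (1 * fine (mu [set: X])); first exact: Rintegral_cst.
  by rewrite probability_setT mul1r.
have iU (mu : probability X R) r B : measurable B -> mu.-integrable setT (EFin \o r) ->
    mu.-integrable setT (EFin \o (r \* (fun z => g z (y 0%N) * pw 0 n B z))).
  by move=> mB; exact: path_weight_step_integrable.
set al := _ ^+ (_ - _); set be := M ^+ 2 * _.
have ee' : 0 <= (e / e') ^+ 2 <= 1.
  have e'0 : 0 < e' by exact: lt_le_trans e_le.
  rewrite sqr_ge0/= expr_le1 ?divr_ge0 ?(ltW e_gt0) ?(ltW e'0)//.
  by rewrite ler_pdivrMr// mul1r.
have := antisymmetric_step (mu1 := nu) (mu2 := nu') (q1 := cst 1) (q2 := cst 1)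
  (s1 := cst 0) (s2 := cst 0) (U := fun z => g z (y 0%N) * pw 0 n A z)
  (V := fun z => g z (y 0%N) * pw 0 n setT z) (alpha := al) (beta := be)
  (int1 nu) (int1 nu') (iU _ _ _ mA (int1 nu)) (iU _ _ _ measurableT (int1 nu))
  (iU _ _ _ mA (int1 nu')) (iU _ _ _ measurableT (int1 nu'))
  (iU _ _ _ mA (int0 nu)) (iU _ _ _ measurableT (int0 nu))
  (iU _ _ _ mA (int0 nu')) (iU _ _ _ measurableT (int0 nu'))
  (I1 nu) (I1 nu').
have E1 (mu : probability X R) B : measurable B ->
    \int[mu]_z (cst 1 z * (g z (y 0%N) * pw 0 n B z)) = fw mu n B.
  by move=> mB; rewrite filter_weightE//; apply: eq_Rintegral => z _; rewrite /= mul1r.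
have E0 (mu : probability X R) B : measurable B ->
    \int[mu]_z (cst 0 z * (g z (y 0%N) * pw 0 n B z)) = 0.
  move=> mB; transitivity (0 * fine (mu [set: X])); last by rewrite mul0r.
  rewrite -Rintegral_cst//; apply: eq_Rintegral => z _.
  by rewrite /= mul0r.
rewrite !E1// !E0// !mul0r !subr0 => H.
rewrite /filtering -/(fw nu n A) -/(fw nu n setT) -/(fw nu' n A) -/(fw nu' n setT).
rewrite -(ler_pM2r (mulr_gt0 L0 L0')) [leRHS]mulrDl divfK ?mulf_neq0 ?gt_eqF//.
rewrite (_ : (_ - _) * _ = fw nu n A * fw nu' n setT - fw nu n setT * fw nu' n A); last first.
  by field; rewrite !gt_eqF.
apply: H => z z'.
rewrite /= subr0 !mul1r.
set gz := g z _; set gz' := g z' _.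
have gz0 : 0 < gz := likelihood_gt0 _ _; have gz'0 : 0 < gz' := likelihood_gt0 _ _.
rewrite (_ : gz * _ * _ - _ = gz * gz' * (pw 0 n A z * pw 0 n setT z'
   - pw 0 n setT z * pw 0 n A z')); last by ring.
have vv0 : 0 <= pw 0 n setT z * pw 0 n setT z' by rewrite mulr_ge0// path_weight_ge0.
have gg0 : 0 <= gz * gz' by rewrite mulr_ge0// ltW.
have := path_weight_contraction mC e_gt0 e_le good_density eta_gt0 eta_out
  n 0 m z z' mA.
move/(ler_wpM2l gg0)/le_trans; apply.
rewrite mulrDr lerD//.
  rewrite [leRHS](_ : _ = gz * gz' * (al * (pw 0 n setT z * pw 0 n setT z'))); last by ring.
  apply: ler_wpM2l => //; apply: ler_wpM2r => //.
  rewrite /al ler_wiXn2l//.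
  - by move: ee'; lra.
  - by move: ee'; lra.
  - by move: (count _ _) (m) (outside _ _ _ _); clear => K j []; lia.
rewrite /be ler_wpM2r ?mulr_ge0 ?exprn_ge0 ?divr_ge0 ?(ltW eta_gt0) ?(ltW M_gt0)//.
by rewrite expr2 ler_pM ?(ltW gz0) ?(ltW gz'0)// likelihood_le.
Qed.

End filtering_contraction.

End filter.

(** * Densities, local sets and rates *)

Section gamma_bounds.
Context (R : realType) (N : nat) (gamma : 'rV[R]_N -> R).
Hypothesis gamma_gt0 : forall s, 0 < gamma s.
Hypothesis gamma_bnd : forall r : R, 0 <= r ->
  ((0 < gamma_minus gamma r) && (gamma_plus gamma r < +oo))%E.

Lemma gamma_minus_fin r : 0 <= r ->
  gamma_minus gamma r = (fine (gamma_minus gamma r))%:E /\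
  0 < fine (gamma_minus gamma r).
Proof.
move=> r0; have /andP[g0 _] := gamma_bnd r0.
have goo : (gamma_minus gamma r < +oo)%E.
  apply: (@le_lt_trans _ _ (gamma 0)%:E); last exact: ltry.
  by apply: ereal_inf_lbound; exists 0 => //=; rewrite enorm0.
split; last by rewrite fine_gt0// g0.
by rewrite fineK// ge0_fin_numE// ltW.
Qed.

Lemma gamma_minus_le r s : enorm s <= r -> fine (gamma_minus gamma r) <= gamma s.
Proof.
move=> sr; have r0 := le_trans (enorm_ge0 s) sr.
by rewrite -lee_fin -(gamma_minus_fin r0).1; apply: ereal_inf_lbound; exists s.
Qed.

Lemma gamma_plus_ge r s : enorm s <= r -> gamma s <= fine (gamma_plus gamma r).
Proof.
move=> sr; have r0 := le_trans (enorm_ge0 s) sr.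
have /andP[_ goo] := gamma_bnd r0.
have gs : ((gamma s)%:E <= gamma_plus gamma r)%E.
  by apply: ereal_sup_ubound; exists s.
rewrite -lee_fin fineK// ge0_fin_numE//.
by apply: le_trans gs; rewrite lee_fin ltW.
Qed.

Lemma gamma_minus_anti r r' : 0 <= r -> r <= r' ->
  fine (gamma_minus gamma r') <= fine (gamma_minus gamma r).
Proof.
move=> r0 rr'; have r'0 := le_trans r0 rr'.
rewrite -lee_fin -(gamma_minus_fin r0).1 -(gamma_minus_fin r'0).1.
by apply: ereal_inf_le_tmp => _ [s sr <-]; exists s => //; exact: le_trans sr rr'.
Qed.

(** Truncating the radius at 0 makes this function monotone on the whole line. *)
Definition log_gamma (r : R) : R := - ln (fine (gamma_minus gamma (Num.max 0 r))).

Lemma log_gamma_nd : {homo log_gamma : r r' / r <= r'}.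
Proof.
move=> r r' rr'; have m0 (t : R) : 0 <= Num.max 0 t by rewrite le_max lexx.
rewrite /log_gamma lerN2 ler_ln ?posrE ?(gamma_minus_fin (m0 _)).2//.
apply: gamma_minus_anti => //.
by rewrite ge_max !le_max lexx rr' !orbT.
Qed.

Lemma measurable_log_gamma : measurable_fun setT log_gamma.
Proof. by apply: nondecreasing_measurable => // r r'; exact: log_gamma_nd. Qed.

Lemma log_gammaE r : 0 <= r -> (- lne (gamma_minus gamma r) = (log_gamma r)%:E)%E.
Proof.
move=> r0; have [E g0] := gamma_minus_fin r0.
by rewrite /log_gamma (max_idPr r0) E lne_EFin.
Qed.

(** The positive part is enough to bound the density from below, and makes the
    law of large numbers for nonnegative variables applicable. *)
Definition log_gamma_pos (r : R) : R := Num.max 0 (log_gamma r).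

Lemma gamma_minus_ge r : 0 <= r -> expR (- log_gamma_pos r) <= fine (gamma_minus gamma r).
Proof.
move=> r0; have [E g0] := gamma_minus_fin r0.
rewrite -[leRHS](@lnK _ (fine (gamma_minus gamma r))) ?posrE// ler_expR.
by rewrite lerNl /log_gamma_pos /log_gamma (max_idPr r0) le_max lexx orbT.
Qed.

End gamma_bounds.

Section observation_function.
Context (R : realType) (N p : nat) (h : 'rV[R]_N -> 'rV[R]_p).

Lemma measurable_local_set y (Delta : R) : measurable_fun setT h ->
  measurable (local_set h y Delta).
Proof.
move=> mh; rewrite (_ : local_set h y Delta =
    setT `&` (fun x => enorm (h x - y)) @^-1` `]-oo, Delta]).
  apply: (measurableT_comp (@measurable_enorm R p)) => //.
  exact: measurable_fun_rVB.
by rewrite setTI; apply/seteqP; split => x /=; rewrite in_itv.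
Qed.

(** Uniform continuity and surjectivity give a cube of fixed size in each local
    set. *)
Lemma local_set_volume (Delta : R) : 0 < Delta -> measurable_fun setT h -> unif_continuous h ->
  (forall y, exists x, h x = y) ->
  exists v : R, 0 < v /\ forall y, (v%:E <= @lebesgue_rV R N (local_set h y Delta))%E.
Proof.
move=> D0 mh huc hsurj.
pose dl : R := Delta / p.+1%:R.
have dl0 : 0 < dl by rewrite divr_gt0.
have entD : entourage [set xy : 'rV[R]_p * 'rV[R]_p | ball xy.1 dl xy.2].
  exact: entourage_ball (PosNum dl0).
have := huc _ entD.
rewrite /= -entourage_ballE => -[r /= r0 rh].
exists (r ^+ N); split; first by rewrite exprn_gt0.
move=> y; have [x hx] := hsurj y.
pose box : set 'rV[R]_N :=
  [set v | forall i, v 0 i \in `](x 0 i - r / 2), (x 0 i + r / 2)]].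
have mbox : measurable box.
  rewrite (_ : box = \bigcap_(i in [set: 'I_N])
      ((fun v : 'rV[R]_N => v 0 i) @^-1` [set` `](x 0 i - r / 2), (x 0 i + r / 2)]])).
    apply: fin_bigcap_measurable => // i _.
    by rewrite -[X in measurable X]setTI; exact: measurable_coord.
  by apply/seteqP; split => v /= Hv; [move=> i _; exact: Hv|move=> i; exact: Hv].
have <- : @lebesgue_rV R N box = (r ^+ N)%:E.
  rewrite lebesgue_rV_box; last by move=> i; have : 0 < r by []; lra.
  by rewrite (eq_bigr (fun=> r)) ?prodr_const ?card_ord// => i _; field.
apply: le_measure; rewrite ?inE//; first exact: measurable_local_set.
move=> v /= Hv; rewrite /local_set /= -hx enormB.
have /= hxv : ball (h x) dl (h v).
  apply: (rh (x, v)) => /=; split => // i j; rewrite (ord1 i) /ball /=.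
  have := Hv j; rewrite in_itv/= ltr_distlC => /andP[h1 h2].
  by apply/andP; split; have : 0 < r by []; lra.
apply: (@le_trans _ _ (p%:R * dl)).
  apply: ler_enorm_sup; first exact: ltW.
  by move=> i; rewrite !mxE ltW//; exact: hxv.2.
rewrite /dl mulrCA ger_pMr// ler_pdivrMr// mul1r ler_nat.
by [].
Qed.

End observation_function.

(** The ball is contained in a cube, which is compact. *)
Lemma density_lower_ball (R : realType) (p : nat) (upsilon : 'rV[R]_p -> R) (Delta : R) :
  (forall u, 0 < upsilon u) ->
  (forall K : set 'rV[R]_p, compact K -> (0 < ereal_inf [set (upsilon y)%:E | y in K])%E) ->
  exists k : R, 0 < k /\ forall u, enorm u <= Delta -> k <= upsilon u.
Proof.
move=> u0 uK.
have [D0|D0] := ltP Delta 0.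
  exists 1; split => // u uD.
  by have := le_lt_trans (le_trans (enorm_ge0 u) uD) D0; rewrite ltxx.
pose K : set 'rV[R]_p := [set v | forall i, `[- Delta, Delta]%classic (v 0 i)].
have cK : compact K.
  apply: (@rV_compact _ _ (fun=> `[- Delta, Delta]%classic)) => i.
  exact: segment_compact.
have inf0 := uK K cK.
set I := ereal_inf _ in inf0.
have K0 : K 0 by move=> i; rewrite /= in_itv/= mxE oppr_le0 D0.
have Ioo : I \is a fin_num.
  rewrite ge0_fin_numE ?(ltW inf0)//; apply: (@le_lt_trans _ _ (upsilon 0)%:E).
    by apply: ereal_inf_lbound; exists 0.
  exact: ltry.
exists (fine I); split; first by rewrite fine_gt0// inf0 -ge0_fin_numE// ltW.
move=> u uD; rewrite -lee_fin fineK//; apply: ereal_inf_lbound; exists u => // i.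
by rewrite /= in_itv/= -ler_norml; exact: le_trans (ler_coord_enorm u i) uD.
Qed.

Section signal.
Context (R : realType) (N p : nat) (f : 'rV[R]_N -> 'rV[R]_N) (h : 'rV[R]_N -> 'rV[R]_p).
Variables (a b0 b : R).
Hypotheses (a0 : 0 <= a) (b00 : 0 <= b0) (b_0 : 0 <= b).
Hypothesis f_lip : forall x1 x2, enorm (f x1 - f x2) <= a * enorm (x1 - x2).
Hypothesis h_inv : forall x1 x2, enorm (x1 - x2) <= b0 + b * enorm (h x1 - h x2).

(** The argument of gamma^- in the definition of Z_k, as a function of the noises
    of one step. *)
Definition radius (Delta : R) (v : 'rV[R]_p * 'rV[R]_p * 'rV[R]_N) : R :=
  2 * (a + 1) * b0 + (a + 1) * b * Delta +
  a * b * enorm v.1.1 + enorm v.2 + b * enorm v.1.2.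

Lemma radius_ge0 Delta v : 0 <= Delta -> 0 <= radius Delta v.
Proof.
by move=> D0; rewrite /radius !addr_ge0 ?mulr_ge0 ?enorm_ge0 ?addr_ge0.
Qed.

Lemma measurable_radius Delta : measurable_fun setT (radius Delta).
Proof.
have m1 := @measurable_fst _ _ ('rV[R]_p * 'rV[R]_p)%type 'rV[R]_N.
have m2 := @measurable_snd _ _ ('rV[R]_p * 'rV[R]_p)%type 'rV[R]_N.
have n1 := @measurable_fst _ _ 'rV[R]_p 'rV[R]_p.
have n2 := @measurable_snd _ _ 'rV[R]_p 'rV[R]_p.
have me n := @measurable_enorm R n.
apply: measurable_funD; [apply: measurable_funD; [apply: measurable_funD => //|]|].
- apply: measurable_funM => //.
  exact: (measurableT_comp (me p) (measurableT_comp n1 m1)).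
- exact: (measurableT_comp (me N) m2).
- apply: measurable_funM => //.
  exact: (measurableT_comp (me p) (measurableT_comp n2 m1)).
Qed.

(** Two points of consecutive local sets are compared with the true states,
    whose distance to the local sets is controlled by the observation noise. *)
Lemma local_set_distance (X X' : 'rV[R]_N) (e e' : 'rV[R]_p) (z : 'rV[R]_N) Delta x x' :
  0 <= Delta -> X' = f X + z ->
  local_set h (h X + e) Delta x -> local_set h (h X' + e') Delta x' ->
  enorm (x' - f x) <= radius Delta (e, e', z).
Proof.
move=> D0 X'E xC x'C; rewrite /radius /=.
have dX : enorm (X - x) <= b0 + b * (Delta + enorm e).
  rewrite (le_trans (h_inv _ _))// lerD2l ler_wpM2l//.
  rewrite (_ : h X - h x = (h X + e - h x) - e); last by rewrite [X in _ = X - _]addrAC addrK.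
  rewrite (le_trans (ler_enormD _ _))// lerD//; first by rewrite enormB.
  by rewrite -[- e]sub0r enormB subr0.
have dX' : enorm (x' - X') <= b0 + b * (Delta + enorm e').
  rewrite (le_trans (h_inv _ _))// lerD2l ler_wpM2l//.
  rewrite (_ : h x' - h X' = (h x' - (h X' + e')) + e'); last by rewrite opprD addrA subrK.
  by rewrite (le_trans (ler_enormD _ _))// lerD2r.
have dZ : enorm (X' - f x) <= a * (b0 + b * (Delta + enorm e)) + enorm z.
  rewrite X'E addrAC (le_trans (ler_enormD _ _))// lerD2r (le_trans (f_lip _ _))//.
  by rewrite ler_wpM2l.
have := ler_enorm_dist X' x' (f x).
have : 0 <= (a + 1) * b0 by rewrite mulr_ge0// addr_ge0.
nra.
Qed.

End signal.

Lemma limn_esup_lt0 (R : realType) (u : nat -> \bar R) (dl : R) n0 : 0 < dl ->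
  (forall n, (n0 <= n)%N -> (u n <= (- dl)%:E)%E) -> (limn_esup u < 0)%E.
Proof.
move=> dl0 H; apply: (@le_lt_trans _ _ (- dl)%:E); last by rewrite lte_fin oppr_lt0.
rewrite limn_esup_lim; apply: lime_le; first exact: is_cvg_esups.
exists n0 => // m /= nm; apply: ge_ereal_sup => _ [n /= mn <-].
by apply: H; exact: leq_trans nm mn.
Qed.

(** The rate - (ln t) / 16 is half of the one suggested by the bound; the other
    half absorbs the constant and the rounding of n / 8. *)
Lemma exponential_rate (R : realType) (v : nat -> \bar R) (C t : R) n0 :
  0 < C -> 0 < t -> t < 1 ->
  (forall n, (n0 <= n)%N -> (v n <= (C * t ^+ (n %/ 8))%:E)%E) ->
  (limn_esup (fun n => (n%:R^-1)%:E * lne (v n)) < 0)%E.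
Proof.
move=> C0 t0 t1 H.
have lt0 : ln t < 0 by rewrite -ln1 ltr_ln ?posrE.
pose dl := - ln t / 16.
have dl0 : 0 < dl by rewrite divr_gt0// oppr_gt0.
pose n1 := (Num.truncn ((`|ln C| - ln t) / dl)).+1.
apply: (@limn_esup_lt0 _ _ dl (maxn n0 n1.+1) dl0) => n; rewrite geq_max => /andP[n0n n1n].
have n_gt0 : 0 < n%:R :> R by rewrite ltr0n (leq_ltn_trans _ n1n).
have [v0|v0] := leP (v n) 0%E.
  by rewrite le0_lneNy// mulrNy gtr0_sg ?invr_gt0// mul1e leNye.
have Ct0 : 0 < C * t ^+ (n %/ 8) by rewrite mulr_gt0// exprn_gt0.
have lv : (lne (v n) <= (ln (C * t ^+ (n %/ 8)))%:E)%E.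
  rewrite -lne_EFin// lee_lne ?H//; rewrite in_itv/= ?leey ?andbT ?(ltW v0)//.
  by rewrite lee_fin ltW.
apply: (@le_trans _ _ ((n%:R^-1)%:E * (ln (C * t ^+ (n %/ 8)))%:E)%E).
  by rewrite lee_wpmul2l// lee_fin invr_ge0 ltW.
rewrite -EFinM lee_fin mulrC ler_pdivrMr//.
rewrite lnM ?posrE ?exprn_gt0// lnXn// -mulr_natl.
have dln : `|ln C| - ln t <= dl * n%:R.
  rewrite mulrC -ler_pdivrMr// (le_trans (ltW (truncnS_gt _)))// ler_nat.
  exact: leq_trans (leqnSn _) n1n.
have n8 : n%:R <= 8 * (n %/ 8)%:R + 8 :> R.
  by rewrite -natrM -natrD ler_nat; clear; lia.
have := ler_norm (ln C).
rewrite /dl in dln dl0 *; nra.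
Qed.

(** * Forgetting along a trajectory *)

(** A time that is not good is charged to an exceedance of the first kind, at that
    time or at the previous one, or to one of the second kind. *)
Lemma count_good_times (R : realType) (bad1 bad2 good : pred nat) n :
  (forall i, ~~ bad1 i -> ~~ bad1 i.+1 -> ~~ bad2 i.+1 -> good i.+1) ->
  n%:R <= (count good (iota 1 n))%:R + \sum_(i < n) (bad1 i)%:R
    + \sum_(i < n.+1) (bad1 i)%:R + \sum_(i < n.+1) (bad2 i)%:R :> R.
Proof.
move=> H; elim: n => [|n IH].
  by rewrite !addr_ge0// ?sumr_ge0// => i _; rewrite ler0n.
have E : iota 1 n.+1 = iota 1 n ++ [:: n.+1] by rewrite -[in LHS](addn1 n) iotaD.
rewrite E count_cat/= addn0 natrD.
rewrite [X in _ + X + _ + _]big_ord_recr/= [X in _ + X + _]big_ord_recr/=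
  [X in _ + X]big_ord_recr/= -[leLHS]natr1.
have : 1 <= (good n.+1)%:R + (bad1 n)%:R + (bad1 n.+1)%:R + (bad2 n.+1)%:R :> R.
  rewrite -!natrD ler1n; have := H n.
  case: (bad1 n) => [_|/(_ isT)]; first by rewrite addn1.
  case: (bad1 n.+1) => [_|/(_ isT)]; first by rewrite addn1.
  by case: (bad2 n.+1) => [_|/(_ isT) ->//]; rewrite addn1.
lra.
Qed.

Section forgetting.
Context (R : realType) (N p : nat).
Local Notation X := 'rV[R]_N.
Local Notation Y := 'rV[R]_p.
Variables (f : X -> X) (h : X -> Y) (upsilon : Y -> R) (gamma : X -> R) (M : R).
Hypotheses (mf : measurable_fun setT f) (mh : measurable_fun setT h).
Hypotheses (mupsilon : measurable_fun setT upsilon) (mgamma : measurable_fun setT gamma).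
Hypotheses (upsilon_gt0 : forall u, 0 < upsilon u) (gamma_gt0 : forall s, 0 < gamma s).
Hypothesis gamma_int : (\int[@lebesgue_rV R N]_z (gamma z)%:E = 1)%E.
Hypothesis upsilon_le : forall u, upsilon u <= M.
Hypothesis gamma_bnd : forall r : R, 0 <= r ->
  ((0 < gamma_minus gamma r) && (gamma_plus gamma r < +oo))%E.
Variables (a b0 b : R).
Hypotheses (a0 : 0 <= a) (b00 : 0 <= b0) (b_0 : 0 <= b).
Hypothesis f_lip : forall x1 x2, enorm (f x1 - f x2) <= a * enorm (x1 - x2).
Hypothesis h_inv : forall x1 x2, enorm (x1 - x2) <= b0 + b * enorm (h x1 - h x2).
(* A trajectory of the signal, the noises and the observations. *)
Variables (x_ : nat -> X) (e_ : nat -> Y) (z_ : nat -> X).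
Hypothesis x_S : forall k, x_ k.+1 = f (x_ k) + z_ k.+1.
Let y k := h (x_ k) + e_ k.
Let noise k := (e_ k, e_ k.+1, z_ k.+1).
Local Notation rad Delta v := (radius a b0 b Delta v).
Local Notation fw := (filter_weight f h upsilon gamma y).
Local Notation phi := (filtering f h upsilon gamma).

Section likelihood.
Variables (Delta k0 v0 c : R) (n0 : nat).
Hypotheses (Delta_gt0 : 0 < Delta) (k0_gt0 : 0 < k0) (v0_gt0 : 0 < v0).
Hypothesis upsilon_ge : forall u, enorm u <= Delta -> k0 <= upsilon u.
Hypothesis volume_ge : forall u, (v0%:E <= @lebesgue_rV R N (local_set h u Delta))%E.
Hypothesis noise_sum : forall n, (n0 <= n)%N ->
  \sum_(i < n) log_gamma_pos gamma (rad Delta (noise i)) <= c * n%:R.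

(** At most 1, so that the n - 1 factors from time 2 to time n are worth at least
    kappa ^ n. *)
Let kappa := Num.min 1 (k0 * v0).
Let kappa_gt0 : 0 < kappa. Proof. by rewrite lt_min ltr01 mulr_gt0. Qed.
Let L k := local_set h (y k) Delta.

(** Each step of the restricted signal contributes at least the lower bound of
    the transition density, the lower bound k0 of the likelihood and the volume
    v0 of the local set. *)
Lemma likelihood_lower (nu : probability X R) n : (0 < n)%N -> (n0 <= n)%N ->
  0 < fw nu 1 (L 1%N) /\
  fw nu 1 (L 1%N) * (kappa * expR (- c)) ^+ n <= fw nu n setT.
Proof.
have mL k : measurable (L k) by exact: measurable_local_set.
case: n => // n _ n0n; split.
  apply: (filter_weight1_gt0 (M := M)) => //.
  by apply: lt_le_trans (volume_ge _); rewrite lte_fin.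
pose l i := kappa * expR (- log_gamma_pos gamma (rad Delta (noise i.-1))).
have l0 i : 0 <= l i by rewrite mulr_ge0 ?expR_ge0 ?(ltW kappa_gt0).
have prodE j : kappa ^+ j *
    expR (- \sum_(i < j.+1) log_gamma_pos gamma (rad Delta (noise i))) <=
    \prod_(i <- iota 2 j) l i.
  elim: j => [|j IH].
    rewrite big_nil expr0 mul1r big_ord1 -expR0 ler_expR oppr_le0.
    by rewrite le_max lexx.
  have -> : iota 2 j.+1 = iota 2 j ++ [:: j.+2] by rewrite -[in LHS](addn1 j) iotaD.
  rewrite big_cat big_seq1 /l /= big_ord_recr/= opprD expRD exprSr mulrACA.
  by rewrite ler_wpM2r// mulr_ge0 ?expR_ge0 ?(ltW kappa_gt0).
have lower : fw nu 1 (L 1%N) * \prod_(i <- iota 2 n) l i <= fw nu n.+1 setT.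
  apply: (filter_weight_lower (M := M)) => // k x Lx.
  rewrite /l /=.
  set r := rad Delta _.
  have r0 : 0 <= r by apply: radius_ge0 => //; exact: ltW.
  have g0 := gamma_minus_ge gamma_bnd r0.
  apply: (@le_trans _ _ (expR (- log_gamma_pos gamma r) * k0 * v0)).
    rewrite mulrC -mulrA ler_wpM2l ?expR_ge0//.
    by rewrite /kappa ge_min lexx orbT.
  apply: (path_weight1_lower (M := M)) => //.
    by rewrite mulr_ge0 ?expR_ge0// ltW.
  2: exact: volume_ge.
  move=> z Lz; rewrite ler_pM ?expR_ge0// ?(ltW k0_gt0)//.
    apply: (le_trans g0); apply: gamma_minus_le => //.
    exact: (local_set_distance a0 b00 b_0 f_lip h_inv (ltW Delta_gt0) (x_S k.+1) Lx Lz).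
  by apply: upsilon_ge; rewrite enormB.
apply: le_trans lower; apply: ler_wpM2l.
  exact: (filter_weight_ge0 (M := M)).
apply: le_trans (prodE n).
rewrite exprMn exprS -mulrA [leLHS]mulrCA ler_wpM2l ?exprn_ge0 ?(ltW kappa_gt0)//.
apply: (@le_trans _ _ (expR (- c) ^+ n.+1)).
  by rewrite ler_piMl ?exprn_ge0 ?expR_ge0// /kappa ge_min lexx.
by rewrite -expRM_natl ler_expR mulrN lerN2 mulrC noise_sum.
Qed.

End likelihood.

Section contraction_rate.
Variables (rho Delta B : R) (n1 : nat).
Hypotheses (rho_gt0 : 0 < rho) (Delta_ge0 : 0 <= Delta) (B_ge0 : 0 <= B).
(** The likelihood bounds are worth rho ^ n each and the integral of a pair at
    most M ^ (2 n), so that n steps cost at most growth ^ n. As n is at most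
    8 (n %/ 8) + 8, the choice of eta gains a factor 2 per budget unit if the
    budget is n %/ 8. *)
Let growth := Num.max 1 (M ^+ 2 / rho ^+ 2).
Let eta := M / (2 * growth ^+ 8).
Hypothesis tail : forall u, Delta < enorm u -> upsilon u <= eta.
Hypothesis freq_e : forall n, (n1 <= n)%N ->
  \sum_(i < n) (B < enorm (e_ i))%R%:R <= 12^-1 * n%:R :> R.
Hypothesis freq_z : forall n, (n1 <= n)%N ->
  \sum_(i < n) (B < enorm (z_ i))%R%:R <= 12^-1 * n%:R :> R.

Let M_gt0 : 0 < M. Proof. exact: lt_le_trans (upsilon_gt0 0) (upsilon_le 0). Qed.
Let growth_ge1 : 1 <= growth. Proof. by rewrite le_max lexx. Qed.
Let growth_gt0 : 0 < growth. Proof. exact: lt_le_trans ltr01 growth_ge1. Qed.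
Let eta_gt0 : 0 < eta. Proof. by rewrite divr_gt0// mulr_gt0// exprn_gt0. Qed.

Let etaM_ge0 : 0 <= eta / M. Proof. by rewrite divr_ge0// ltW. Qed.

(** A bound for the radius of all the good times. *)
Let rB := 2 * (a + 1) * b0 + (a + 1) * b * Delta + a * b * B + B + b * B.
Let lo := fine (gamma_minus gamma rB).
Let hi := fine (gamma_plus gamma rB).
Let theta := 1 - (lo / hi) ^+ 2.
Let rate := Num.max theta 2^-1.

Let good k := [&& enorm (e_ k.-1) <= B, enorm (e_ k) <= B & enorm (z_ k) <= B].
Let C k := local_set h (y k) Delta.

Let radius_le k : good k.+1 -> rad Delta (noise k) <= rB.
Proof.
move=> /and3P[/= e1 e2 z1]; rewrite /rB /radius /noise /=; apply: lerD; last by rewrite ler_wpM2l.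
by apply: lerD => //; rewrite lerD2l ler_wpM2l// mulr_ge0.
Qed.

Let rB_ge0 : 0 <= rB.
Proof. by rewrite !addr_ge0 ?mulr_ge0 ?addr_ge0. Qed.

Let lo_gt0 : 0 < lo. Proof. exact: (gamma_minus_fin gamma_bnd rB_ge0).2. Qed.

Let lo_le_hi : lo <= hi.
Proof.
apply: (@le_trans _ _ (gamma 0)).
  by apply: gamma_minus_le => //; rewrite enorm0.
by apply: gamma_plus_ge => //; rewrite enorm0.
Qed.

Let good_density k x z : good k.+1 -> C k x -> C k.+1 z ->
  lo <= gamma (z - f x) <= hi.
Proof.
move=> gk xC zC.
have zx : enorm (z - f x) <= rB.
  apply: le_trans (radius_le gk).
  exact: (local_set_distance a0 b00 b_0 f_lip h_inv Delta_ge0 (x_S k) xC zC).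
by apply/andP; split; [exact: gamma_minus_le|exact: gamma_plus_ge].
Qed.

Let rate_itv : 0 < rate < 1.
Proof.
have hi_gt0 : 0 < hi by exact: lt_le_trans lo_le_hi.
have : 0 < (lo / hi) ^+ 2 by rewrite exprn_gt0// divr_gt0.
rewrite /rate /theta lt_max gt_max => lh; apply/andP; split.
  by apply/orP; right; lra.
by apply/andP; split; lra.
Qed.

Let theta_ge0 : 0 <= theta.
Proof.
have hi_gt0 : 0 < hi by exact: lt_le_trans lo_le_hi.
rewrite subr_ge0 expr_le1 ?divr_ge0 ?(ltW lo_gt0) ?(ltW hi_gt0)//.
by rewrite ler_pdivrMr// mul1r.
Qed.

(** The three kinds of exceedances have frequency at most 1 / 12 each; of the
    remaining proportion 3 / 4 of good times, the budget n %/ 8 spoils about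
    1 / 4, which leaves more than 1 / 8. *)
Let enough_good_times n : (n1 <= n)%N -> (8 <= n)%N ->
  (n %/ 8 <= count good (iota 1 n) - (2 * (n %/ 8)).+1)%N.
Proof.
move=> n1n n8.
have := @count_good_times R (fun i => B < enorm (e_ i)) (fun i => B < enorm (z_ i)) good n.
rewrite /good => /(_ _) H.
have {H} := H (fun i => ltac:(rewrite -!leNgt => -> -> ->; exact: isT)).
have := freq_e n1n; have := freq_e (leqW n1n); have := freq_z (leqW n1n).
rewrite -[n.+1%:R]natr1 => h1 h2 h3 h4.
have : 4 * n%:R <= 4 * (count good (iota 1 n))%:R + n%:R + 1 :> R.
  by move: h1 h2 h3 h4; rewrite -/good; lra.
rewrite -!natrM -natrD natr1 ler_nat.
by move: (count _ _) n8; clear; lia.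
Qed.

Let forgetting_one_sided (nu nu' : probability X R) (c1 c2 : R) n A :
  0 < c1 -> 0 < c2 -> (n1 <= n)%N -> (8 <= n)%N ->
  c1 * rho ^+ n <= fw nu n setT -> c2 * rho ^+ n <= fw nu' n setT ->
  measurable A ->
  phi nu n y A - phi nu' n y A <=
  (1 + M ^+ 2 * growth ^+ 8 / (c1 * c2)) * rate ^+ (n %/ 8).
Proof.
move=> c10 c20 n1n n8 low1 low2 mA; set m := (n %/ 8)%N.
have rn0 : 0 < rho ^+ n by rewrite exprn_gt0.
have L1 : 0 < fw nu n setT by apply: lt_le_trans low1; rewrite mulr_gt0.
have L2 : 0 < fw nu' n setT by apply: lt_le_trans low2; rewrite mulr_gt0.
have /andP[rate0 rate1] := rate_itv.
have := filtering_contraction (M := M) mf mh mupsilon mgamma upsilon_gt0 gamma_gt0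
  gamma_int upsilon_le (y := y) (nu := nu) (nu' := nu') (C := C) (good := good)
  (e := lo) (e' := hi) (eta := eta) (fun k => measurable_local_set (y k) Delta mh)
  lo_gt0 lo_le_hi good_density eta_gt0.
move=> /(_ _ n m A mA L1 L2) H.
apply: (le_trans (H _)) => [k x /negP|].
  by rewrite -ltNge enormB => /tail.
rewrite mulrDl mul1r lerD//.
  apply: (@le_trans _ _ (theta ^+ m)).
    rewrite ler_wiXn2l// ?enough_good_times//.
    by rewrite /theta gerBl sqr_ge0.
  by apply: lerXn2r; rewrite ?nnegrE ?(ltW rate0)// le_max lexx.
have LL : c1 * c2 * (rho ^+ 2) ^+ n <= fw nu n setT * fw nu' n setT.
  rewrite -exprM mulnC exprM expr2 mulrACA.
  by rewrite ler_pM// ltW// mulr_gt0.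
have c120 : 0 < c1 * c2 by rewrite mulr_gt0.
apply: (@le_trans _ _ (M ^+ 2 / (c1 * c2) * ((eta / M) ^+ m * growth ^+ n))).
  apply: (@le_trans _ _ (M ^+ 2 * ((eta / M) ^+ m * M ^+ (2 * n)) /
      (c1 * c2 * (rho ^+ 2) ^+ n))).
    apply: ler_wpM2l; last by rewrite lef_pV2 ?posrE ?mulr_gt0 ?exprn_gt0.
    apply: mulr_ge0; first exact: sqr_ge0.
    by apply: mulr_ge0; apply: exprn_ge0; [exact: etaM_ge0|exact: ltW].
  rewrite [leLHS](_ : _ = M ^+ 2 / (c1 * c2) *
      ((eta / M) ^+ m * (M ^+ 2 / rho ^+ 2) ^+ n)); last first.
    rewrite exprM [(M ^+ 2 / rho ^+ 2) ^+ n]expr_div_n; field.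
    by apply/and3P; split; rewrite ?expf_neq0 ?gt_eqF.
  rewrite ler_wpM2l ?divr_ge0 ?sqr_ge0 ?(ltW c120)//.
  apply: ler_wpM2l; first exact: exprn_ge0.
  rewrite ler_pXn2r ?nnegrE ?divr_ge0 ?sqr_ge0 ?(ltW growth_gt0)//.
    by rewrite /growth le_max lexx orbT.
  by rewrite (leq_trans _ n8).
have -> : M ^+ 2 * growth ^+ 8 / (c1 * c2) * rate ^+ m =
    M ^+ 2 / (c1 * c2) * (growth ^+ 8 * rate ^+ m) by field; rewrite !gt_eqF.
rewrite ler_wpM2l ?divr_ge0 ?sqr_ge0 ?(ltW c120)//.
apply: (@le_trans _ _ ((eta / M) ^+ m * growth ^+ (8 + 8 * m))).
  apply: ler_wpM2l; first exact: exprn_ge0.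
  by apply: ler_weXn2l => //; rewrite /m; clear; lia.
rewrite exprD mulrCA ler_wpM2l ?exprn_ge0 ?(ltW growth_gt0)//.
rewrite (_ : eta / M = 2^-1 / growth ^+ 8); last first.
  by rewrite /eta; field; rewrite ?expf_neq0 ?gt_eqF.
rewrite exprM -exprMn divfK ?gt_eqF ?exprn_gt0//.
apply: lerXn2r; rewrite ?nnegrE ?invr_ge0 ?(ltW rate0)//.
by rewrite /rate le_max lexx orbT.
Qed.

Lemma forgetting_rate : exists2 t : R, 0 < t < 1 &
  forall (nu nu' : probability X R) (c1 c2 : R) n A,
  0 < c1 -> 0 < c2 -> (n1 <= n)%N -> (8 <= n)%N ->
  c1 * rho ^+ n <= fw nu n setT -> c2 * rho ^+ n <= fw nu' n setT ->
  measurable A ->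
  `|phi nu n y A - phi nu' n y A| <=
  (1 + M ^+ 2 * growth ^+ 8 / (c1 * c2)) * t ^+ (n %/ 8).
Proof.
exists rate; first exact: rate_itv.
move=> nu nu' c1 c2 n A c10 c20 n1n n8 low1 low2 mA.
rewrite ler_norml lerNl opprB; apply/andP; split; last exact: forgetting_one_sided.
by rewrite [c1 * c2]mulrC; exact: forgetting_one_sided.
Qed.

End contraction_rate.

End forgetting.

(** * Almost sure forgetting *)

(** The state space is a point. *)
Lemma filtering_dim0 (R : realType) p (f : 'rV[R]_0 -> 'rV[R]_0) (h : 'rV[R]_0 -> 'rV[R]_p)
    upsilon gamma (nu nu' : probability 'rV[R]_0 R) n y A :
  filtering f h upsilon gamma nu n y A = filtering f h upsilon gamma nu' n y A.
Proof.
have cst0 (mu : probability 'rV[R]_0 R) (F : 'rV[R]_0 -> \bar R) : (\int[mu]_x F x = F (0 : 'rV[R]_0)%R)%E.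
  rewrite (_ : F = cst (F 0)); last by apply/funext => x; rewrite (thinmx0 x).
  by rewrite integral_cst//= probability_setT mule1.
by rewrite /filtering /unnormalized_filter !cst0.
Qed.

Lemma lipschitz_ge0 (R : realType) N (f : 'rV[R]_N -> 'rV[R]_N) (a : R) : (0 < N)%N ->
  (forall x1 x2, enorm (f x1 - f x2) <= a * enorm (x1 - x2)) -> 0 <= a.
Proof.
move=> N0 f_lip; have := f_lip (const_mx 1) 0; rewrite subr0 => /(le_trans (enorm_ge0 _)).
rewrite pmulr_lge0//; apply: lt_le_trans (ler_coord_enorm _ (Ordinal N0)).
by rewrite mxE normr1.
Qed.

(** If p > 0, then h is unbounded, being surjective, and a negative b would make
    the bound negative; if p = 0, then h is constant and the hypothesis on h would
    bound the whole space. *)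
Lemma inverse_modulus_ge0 (R : realType) N p (h : 'rV[R]_N -> 'rV[R]_p) (b0 b : R) :
  (0 < N)%N -> (forall y, exists x, h x = y) ->
  (forall x1 x2, enorm (x1 - x2) <= b0 + b * enorm (h x1 - h x2)) ->
  0 <= b0 /\ 0 <= b.
Proof.
move=> N0 h_surj h_inv; split.
  by have := h_inv 0 0; rewrite !subrr !enorm0 mulr0 addr0.
case: p => [|p] in h h_surj h_inv *.
  have := h_inv (const_mx (`|b0| + 1)) 0; rewrite subr0 (thinmx0 (h _ - _)) enorm0 mulr0 addr0.
  have := ler_coord_enorm (const_mx (`|b0| + 1) : 'rV[R]_N) (Ordinal N0).
  rewrite mxE => h1 h2; have := le_trans h1 h2.
  have := ler_norm (`|b0| + 1); have := ler_norm b0; lra.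
rewrite leNgt; apply/negP => b_lt0.
have [x1 hx1] := h_surj (const_mx ((`|b0| + 1) / - b)).
have [x2 hx2] := h_surj 0.
have := h_inv x1 x2; rewrite hx1 hx2 subr0 => /(le_trans (enorm_ge0 _)).
have := ler_coord_enorm (const_mx ((`|b0| + 1) / - b) : 'rV[R]_p.+1) ord0.
rewrite mxE => /(le_trans (ler_norm _)).
set E := enorm _ => bE h0.
have : (`|b0| + 1) / - b * - b <= E * - b by rewrite ler_wpM2r// oppr_ge0 ltW.
rewrite divfK ?oppr_eq0 ?lt_eqF// => h1.
by have := ler_norm b0; lra.
Qed.

Theorem mainTheorem3 (R : realType) (N p : nat) (hpN : (p <= N)%N)
  (d : measure_display) (Omega : measurableType d) (P : probability Omega R)
  (f : 'rV[R]_N -> 'rV[R]_N) (h : 'rV[R]_N -> 'rV[R]_p)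
  (upsilon : 'rV[R]_p -> R) (gamma : 'rV[R]_N -> R)
  (X0 : {RV P >-> 'rV[R]_N}) (eps : nat -> {RV P >-> 'rV[R]_p})
  (zeta : nat -> {RV P >-> 'rV[R]_N})
  (a b0 b : R)
  (mf : measurable_fun setT f) (mh : measurable_fun setT h)
  (mupsilon : measurable_fun setT upsilon) (mgamma : measurable_fun setT gamma)
  (upsilon_gt0 : forall u, 0 < upsilon u) (gamma_gt0 : forall s, 0 < gamma s)
  (eps_iid : iid_with_density P eps upsilon)
  (zeta_iid : iid_with_density P zeta gamma)
  (zeta_eps : independent_sigma P (sigma_of zeta) (sigma_of eps))
  (X0_noise : independent_sigma P (sigma_of (fun _ : unit => X0))
                <<s sigma_of eps `|` sigma_of zeta >>)
  (gamma_bnd : forall r : R, 0 <= r ->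
     ((0 < gamma_minus gamma r) && (gamma_plus gamma r < +oo))%E)
  (f_lip : forall x1 x2, enorm (f x1 - f x2) <= a * enorm (x1 - x2))
  (h_uc : unif_continuous h)
  (h_surj : forall y, exists x, h x = y)
  (h_inv : forall x1 x2 : 'rV[R]_N, enorm (x1 - x2) <= b0 + b * enorm (h x1 - h x2))
  (upsilon_bnd : exists M, forall u, upsilon u <= M)
  (upsilon_lim : forall e : R, 0 < e ->
     exists M, forall u, M < enorm u -> `|upsilon u| < e)
  (upsilon_inf : forall K : set 'rV[R]_p, compact K ->
     (0 < ereal_inf [set (upsilon y)%:E | y in K])%E)
  (Z_int : forall Delta : R, 0 < Delta ->
     (\int[P]_w `|Zvar gamma eps zeta a b0 b Delta 1 w| < +oo)%E) :
  let Y := observation f h X0 eps zeta in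
  forall (nu nu' : probability 'rV[R]_N R) (Delta : R), 0 < Delta ->
    {ae P, forall w,
      (0 < \int[nu]_x transition f gamma x (local_set h (Y 1%N w) Delta))%E} ->
    {ae P, forall w,
      (0 < \int[nu']_x transition f gamma x (local_set h (Y 1%N w) Delta))%E} ->
    {ae P, forall w,
      (limn_esup (fun n => (n%:R^-1)%:E * lne (tv_norm (fun A =>
         filtering f h upsilon gamma nu n (Y ^~ w) A -
         filtering f h upsilon gamma nu' n (Y ^~ w) A)%R)) < 0)%E}.
Proof.
move=> Y nu nu' Delta Delta_gt0 _ _.
case: N => [|N'] in hpN f h gamma X0 zeta mf mh mgamma gamma_gt0 zeta_iid zeta_eps X0_noise
  gamma_bnd f_lip h_uc h_surj h_inv Z_int Y nu nu' *.
  apply: nearW => w; apply: (@exponential_rate _ _ 1 2^-1 0) => // [|n _].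
    by lra.
  apply: (@le_trans _ _ (2 * 0)%:E); last by rewrite mulr0 lee_fin mul1r exprn_ge0.
  apply: tv_norm_le => [A B _ _ _|A _]; rewrite !(filtering_dim0 _ _ _ _ nu nu') !subrr ?addr0//.
  by rewrite normr0.
set N := N'.+1 in f h gamma X0 zeta mf mh mgamma gamma_gt0 zeta_iid zeta_eps X0_noise
  gamma_bnd f_lip h_uc h_surj h_inv Z_int Y nu nu' *.
have N0 : (0 < N)%N by [].
have a0 := lipschitz_ge0 N0 f_lip.
have [b00 b_0] := inverse_modulus_ge0 N0 h_surj h_inv.
have [M upsilon_le] := upsilon_bnd.
have M_gt0 : 0 < M by apply: lt_le_trans (upsilon_gt0 0) (upsilon_le 0).
have gamma_int : (\int[@lebesgue_rV R N]_z (gamma z)%:E = 1)%E.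
  have := zeta_iid.2 0%N setT measurableT.
  by rewrite preimage_setT probability_setT => <-.
have [v0 [v0_gt0 volume_ge]] := local_set_volume Delta_gt0 mh h_uc h_surj.
have [k0 [k0_gt0 upsilon_ge]] := density_lower_ball Delta upsilon_gt0 upsilon_inf.
(* The logarithmic weights of the likelihood bound have a finite mean. *)
pose F (v : 'rV[R]_p * 'rV[R]_p * 'rV[R]_N) := log_gamma_pos gamma (radius a b0 b Delta v).
have mF : measurable_fun setT F.
  apply: (@measurable_maxr _ _ _ setT (cst 0)) => //.
  by apply: (measurableT_comp (measurable_log_gamma gamma_bnd)); exact: measurable_radius.
have F0 v : 0 <= F v by rewrite le_max lexx.
have [c Fc] : exists c : R, (\int[P]_w (F (step_noise eps zeta 0 w))%:E < c%:E)%E.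
  have Foo : (\int[P]_w (F (step_noise eps zeta 0 w))%:E < +oo)%E.
    apply: le_lt_trans (Z_int _ Delta_gt0).
    rewrite [leRHS](eq_integral (fun w =>
      (`|log_gamma gamma (radius a b0 b Delta (step_noise eps zeta 0 w))|)%:E)); last first.
      move=> w _; rewrite /Zvar log_gammaE//=.
      exact: (radius_ge0 a0 b00 b_0 (step_noise eps zeta 0 w) (ltW Delta_gt0)).
    apply: ge0_le_integral => //.
    - by move=> w _; rewrite lee_fin.
    - by apply/measurable_EFinP; exact: measurableT_comp.
    - apply/measurable_EFinP; apply: measurableT_comp => //.
      apply: (measurableT_comp (measurable_log_gamma gamma_bnd)).
      by apply: measurableT_comp => //; exact: measurable_radius.
    - by move=> w _; rewrite lee_fin ge_max normr_ge0 ler_norm.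
  exists (fine (\int[P]_w (F (step_noise eps zeta 0 w))%:E) + 1).
  rewrite EFinD fineK ?lteDl ?lte_fin ?ltr01// ge0_fin_numE//.
    by apply: integral_ge0 => w _; rewrite lee_fin.
  by apply: integral_ge0 => w _; rewrite lee_fin.
pose rho := Num.min 1 (k0 * v0) * expR (- (8 * c)).
have rho_gt0 : 0 < rho by rewrite mulr_gt0 ?expR_gt0// lt_min ltr01 mulr_gt0.
(* A second radius: outside of the local sets of this radius, the likelihood is
   too small to compete with the lower bound rho. *)
pose growth := Num.max 1 (M ^+ 2 / rho ^+ 2).
have growth_gt0 : 0 < growth by rewrite lt_max ltr01.
have eta_gt0 : 0 < M / (2 * growth ^+ 8) by rewrite divr_gt0// mulr_gt0// exprn_gt0.
have [D0 D0P] := upsilon_lim _ eta_gt0.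
pose Delta' := Num.max 0 D0.
have Delta'_ge0 : 0 <= Delta' by rewrite le_max lexx.
have tail u : Delta' < enorm u -> upsilon u <= M / (2 * growth ^+ 8).
  rewrite gt_max => /andP[_ /D0P /ltW]; exact: le_trans (ler_norm _).
have c48 : 0 < 48^-1 :> R by rewrite invr_gt0.
have [B1 [B1_ge0 PB1]] := exceedance_small P eps c48.
have [B2 [B2_ge0 PB2]] := exceedance_small P zeta c48.
have := exceedance_frequency zeta_iid PB2.
have := exceedance_frequency eps_iid PB1.
have := step_noise_sum eps_iid zeta_iid zeta_eps mF F0 Fc.
apply: filterS3 => w [m0 noise_sum] [m1 freq1] [m2 freq2].
pose B := Num.max B1 B2.
have B_ge0 : 0 <= B by rewrite le_max B1_ge0.
pose n1 := maxn m0 (maxn m1 m2).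
have freq_e n : (n1 <= n)%N ->
    \sum_(i < n) (B < enorm (eps i w))%R%:R <= 12^-1 * n%:R :> R.
  rewrite !geq_max => /and3P[_ m1n _]; apply: le_trans (_ : _ <= 4 * 48^-1 * n%:R) _; last first.
    by rewrite ler_wpM2r//; lra.
  apply: le_trans (freq1 n m1n); apply: ler_sum => i _.
  by rewrite ler_nat gt_max; case: (B1 < _); case: (B2 < _).
have freq_z n : (n1 <= n)%N ->
    \sum_(i < n) (B < enorm (zeta i w))%R%:R <= 12^-1 * n%:R :> R.
  rewrite !geq_max => /and3P[_ _ m2n]; apply: le_trans (_ : _ <= 4 * 48^-1 * n%:R) _; last first.
    by rewrite ler_wpM2r//; lra.
  apply: le_trans (freq2 n m2n); apply: ler_sum => i _.
  by rewrite ler_nat gt_max; case: (B1 < _); case: (B2 < _).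
pose x_ k := state f X0 zeta k w.
pose e_ k := eps k w.
pose z_ k := zeta k w.
have x_S k : x_ k.+1 = f (x_ k) + z_ k.+1 by [].
have lower (mu : probability 'rV[R]_N R) : exists c1, 0 < c1 /\ forall n, (0 < n)%N ->
    (n1 <= n)%N -> c1 * rho ^+ n <= filter_weight f h upsilon gamma (Y ^~ w) mu n setT.
  have H n (n_gt0 : (0 < n)%N) (n1n : (n1 <= n)%N) :=
    likelihood_lower (e_ := e_) mf mh mupsilon mgamma upsilon_gt0 gamma_gt0 gamma_int upsilon_le
      gamma_bnd a0 b00 b_0 f_lip h_inv x_S Delta_gt0 k0_gt0 v0_gt0 upsilon_ge volume_ge
      noise_sum mu n_gt0 (leq_trans (leq_maxl _ _) n1n).
  have [c1_gt0 _] := H n1.+1 isT (leqnSn _).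
  by exists (filter_weight f h upsilon gamma (Y ^~ w) mu 1 (local_set h (Y 1%N w) Delta));
    split => // n n_gt0 n1n; exact: (H n n_gt0 n1n).2.
have [c1 [c1_gt0 low1]] := lower nu.
have [c2 [c2_gt0 low2]] := lower nu'.
have [t /andP[t_gt0 t_lt1] rate] := forgetting_rate (e_ := e_) mf mh mupsilon mgamma
  upsilon_gt0 gamma_gt0 gamma_int upsilon_le gamma_bnd a0 b00 b_0 f_lip h_inv x_S
  rho_gt0 Delta'_ge0 B_ge0 tail freq_e freq_z.
pose K := 1 + M ^+ 2 * growth ^+ 8 / (c1 * c2).
have K_gt0 : 0 < K.
  by rewrite addr_gt0// divr_gt0// mulr_gt0// exprn_gt0.
apply: (@exponential_rate _ _ (2 * K) t (maxn n1 8)) => //; first by rewrite mulr_gt0.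
move=> n; rewrite geq_max => /andP[n1n n8]; have n_gt0 : (0 < n)%N by rewrite (leq_trans _ n8).
rewrite -mulrA; apply: tv_norm_le => [A1 A2 mA1 mA2 A12|A mA].
  by rewrite !(filtering_additive (M := M))// opprD addrACA.
exact: (rate nu nu' c1 c2 n A c1_gt0 c2_gt0 n1n n8 (low1 n n_gt0 n1n) (low2 n n_gt0 n1n) mA).
Qed.
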